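(* In the $\mathcal{FF}^{PD}_g$-space of dimension $N=3$, the geodesic equation for the arc $\mathcal A(x,l_1,l_2)$ on the indicatrix can be completely integrated, yielding the following explicit dependence of the azimuthal angle $\chi$ and the polar angle $\phi$ on the arc-length parameter $s$: $$\chi(s)=\frac1h\arccos\Bigl(\sqrt{1-h^2\widetilde C^2}\,\cos\bigl(h(s-\widetilde s)\bigr)\Bigr)$$ and $$\phi(s)=\widetilde\phi-\frac{\pi}2+\arctan\Bigl(\frac1{h\widetilde C}\tan\bigl(h(s-\widetilde s)\bigr)\Bigr)\ \ \text{if }\widetilde C\neq0;\qquad \phi=\widetilde\phi\ \ \text{if }\widetilde C=0,$$ where $\widetilde C,\widetilde s,\widetilde\phi$ are integration constants.
   Context: $M$ is a 3-dimensional manifold with Riemannian metric $a_{ij}(x)$ and a 1-form $b=b_i(x)y^i$ of unit length, $a_{ij}b^ib^j=1$, $b^i=a^{ij}b_j$. Let $g=g(x)$ be a scalar with $-2<g<2$ and $h=\sqrt{1-g^2/4}$. Put $q=\sqrt{(a_{mn}-b_mb_n)y^my^n}$, $A=b+\frac12gq$, $B=b^2+gbq+q^2$, $f=\arccos(A/\sqrt B)\in[0,\pi]$, and let the azimuthal angle be $\chi=f/h$. The $\mathcal{FF}^{PD}_g$-Finsleroid metric function is $K(x,y)=\sqrt B\,e^{-\frac12g\chi}$, with metric tensor $g_{ij}=\frac12\partial^2K^2/\partial y^i\partial y^j$. Fix $x\in M$ and an orthonormal frame of $a_{ij}(x)$ in $T_xM$ whose third vector is $b^i(x)$; let $R^1,R^2,R^3$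 be the frame components of $y\in T_xM$, so $R^3=b$, $q=\sqrt{(R^1)^2+(R^2)^2}$. The polar angle $\phi$ is the polar angle in the $(R^1,R^2)$-plane: $R^1=q\cos\phi$, $R^2=q\sin\phi$. The indicatrix at $x$ is $\{y\in T_xM:K(x,y)=1\}$ with the Riemannian metric induced from the tangent Riemannian space $(T_xM,g_{ij}(x,\cdot))$ ($x$ fixed). For unit vectors $l_1,l_2$ (points of the indicatrix), $\mathcal A(x,l_1,l_2)$ is the geodesic arc on the indicatrix joining $l_1$ and $l_2$, and $s$ is its arc length. The considerations are local (away from the axis directions $\pm b^i$ where $\phi$ is undefined, with $\arctan$ taken on a continuous branch). *)

(* Defs.v *)
From HB Require Import structures.
From mathcomp Require Import all_boot all_order all_algebra.
From mathcomp Require Import all_classical all_reals all_analysis.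

Set Implicit Arguments.
Unset Strict Implicit.
Unset Printing Implicit Defensive.

Import Order.TTheory GRing.Theory Num.Theory.
Import numFieldNormedType.Exports.

Local Open Scope classical_set_scope.
Local Open Scope ring_scope.

Section Calculus.
Variable R : realType.

Definition partial (m : nat) (V : normedModType R) (i : 'I_m)
    (f : 'rV[R]_m -> V) : 'rV[R]_m -> V :=
  fun y => 'D_(delta_mx 0 i) f y.

(* C^k on an open set W.  Asking for (Frechet) differentiability at each order
   is no restriction: continuous partial derivatives imply it. *)
Fixpoint Ck (k m : nat) (V : normedModType R) (W : set 'rV[R]_m)
    (f : 'rV[R]_m -> V) : Prop :=
  match k with
  | 0%N => forall y, W y -> {for y, continuous f}
  | k'.+1 => (forall y, W y -> differentiable f y) /\
             (forall i : 'I_m, Ck k' W (partial i f))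
  end.

End Calculus.

Section RiemannianSurfaces.
Variable R : realType.

(* C^2 local coordinates u = (u^0, u^1) on a surface S of R^3, given by the
   inverse y = Y(u), u in W, of the coordinate map. *)
Definition local_chart (S : set 'rV[R]_3) (W : set 'rV[R]_2)
    (Y : 'rV[R]_2 -> 'rV[R]_3) : Prop :=
  [/\ open W, Ck 2 W Y,
      forall u, W u -> S (Y u),
      forall u v, W u -> W v -> Y u = Y v -> u = v
    & forall u, W u -> row_free (\matrix_(a < 2) partial a Y u)].

(* gamma_ab = G_ij(Y) (dY^i/du^a) (dY^j/du^b). *)
Definition induced_metric (G : 'rV[R]_3 -> 'M[R]_3) (Y : 'rV[R]_2 -> 'rV[R]_3)
    (u : 'rV[R]_2) : 'M[R]_2 :=
  \matrix_(a, b) \sum_(i < 3) \sum_(j < 3)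
    G (Y u) i j * partial a Y u 0 i * partial b Y u 0 j.

(* Gamma^a_bc of the Levi-Civita connection of gamma. *)
Definition christoffel (gamma : 'rV[R]_2 -> 'M[R]_2) (u : 'rV[R]_2)
    (a b c : 'I_2) : R :=
  2^-1 * \sum_(d < 2) invmx (gamma u) a d *
    (partial b (fun v => gamma v d c : R^o) u
     + partial c (fun v => gamma v d b : R^o) u
     - partial d (fun v => gamma v b c : R^o) u).

Definition geodesic_equation (gamma : 'rV[R]_2 -> 'M[R]_2)
    (u : R -> 'rV[R]_2) (s : R) : Prop :=
  [/\ derivable u s 1, derivable (derive1 u) s 1
    & forall a : 'I_2,
        derive1 (derive1 u) s 0 a
        + \sum_(b < 2) \sum_(c < 2)
            christoffel gamma (u s) a b c * derive1 u s 0 b * derive1 u s 0 c = 0].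

(* c, restricted to the open set I, is an (affinely parametrized) geodesic of
   S for the metric induced on S by the metric G of R^3. *)
Definition geodesic (S : set 'rV[R]_3) (G : 'rV[R]_3 -> 'M[R]_3)
    (I : set R) (c : R -> 'rV[R]_3) : Prop :=
  forall s, I s ->
    exists (W : set 'rV[R]_2) (Y : 'rV[R]_2 -> 'rV[R]_3)
           (J : set R) (u : R -> 'rV[R]_2),
      [/\ local_chart S W Y, open J, J s
        & forall t, J t ->
            [/\ W (u t), c t = Y (u t)
              & geodesic_equation (induced_metric G Y) u t]].

Definition arc_length_param (G : 'rV[R]_3 -> 'M[R]_3)
    (I : set R) (c : R -> 'rV[R]_3) : Prop :=
  forall s, I s ->
    derivable c s 1 /\
    \sum_(i < 3) \sum_(j < 3) G (c s) i j * derive1 c s 0 i * derive1 c s 0 j = 1.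

End RiemannianSurfaces.

(* The fields a_ij, b_i, g in a coordinate domain of a 3-dimensional manifold.
   Coordinates are indexed from 0, and T_xM is 'rV[R]_3 via the components
   y^i. *)
Record finsleroid_space (R : realType) := FinsleroidSpace {
  dom : set 'rV[R]_3;
  fa : 'rV[R]_3 -> 'M[R]_3;
  fb : 'rV[R]_3 -> 'rV[R]_3;
  fg : 'rV[R]_3 -> R;
  dom_open : open dom;
  fa_smooth : forall k, Ck k dom fa;
  fb_smooth : forall k, Ck k dom fb;
  fg_smooth : forall k, Ck k dom (fg : 'rV[R]_3 -> R^o);
  fa_sym : forall x, dom x -> (fa x)^T = fa x;
  fa_posdef : forall x, dom x -> forall v : 'rV[R]_3, v != 0 ->
    0 < \sum_(i < 3) \sum_(j < 3) fa x i j * v 0 i * v 0 j;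
  fb_unit : forall x, dom x ->
    \sum_(i < 3) \sum_(j < 3) invmx (fa x) i j * fb x 0 i * fb x 0 j = 1;
  fg_bound : forall x, dom x -> -2 < fg x < 2
}.

Section Finsleroid.
Variables (R : realType) (F : finsleroid_space R) (x : 'rV[R]_3).

Implicit Types y : 'rV[R]_3.

Definition b_up : 'rV[R]_3 :=
  \row_(i < 3) \sum_(j < 3) invmx (fa F x) i j * fb F x 0 j.

Definition fh : R := Num.sqrt (1 - fg F x ^+ 2 / 4).

Definition b_form y : R := \sum_(i < 3) fb F x 0 i * y 0 i.

Definition fq y : R :=
  Num.sqrt (\sum_(m < 3) \sum_(n < 3)
    (fa F x m n - fb F x 0 m * fb F x 0 n) * y 0 m * y 0 n).

Definition fA y : R := b_form y + 2^-1 * fg F x * fq y.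

Definition fB y : R := b_form y ^+ 2 + fg F x * b_form y * fq y + fq y ^+ 2.

Definition ff y : R := acos (fA y / Num.sqrt (fB y)).

Definition chi y : R := ff y / fh.

Definition finsler_K y : R :=
  Num.sqrt (fB y) * expR (- (2^-1 * fg F x * chi y)).

Definition metric_tensor y : 'M[R]_3 :=
  \matrix_(i, j)
    (2^-1 * partial i (partial j (fun z => finsler_K z ^+ 2 : R^o)) y).

Definition indicatrix : set 'rV[R]_3 := [set y | finsler_K y = 1].

(* The rows of E are the frame vectors. *)
Definition adapted_frame (E : 'M[R]_3) : Prop :=
  E *m fa F x *m E^T = 1%:M /\ row ord_max E = b_up.

(* The components of y in the frame E: frame_comp E y *m E = y. *)
Definition frame_comp (E : 'M[R]_3) y : 'rV[R]_3 := y *m invmx E.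

(* phi is a continuous determination on I of the polar angle along c. *)
Definition polar_angle_along (E : 'M[R]_3) (I : set R)
    (c : R -> 'rV[R]_3) (phi : R -> R) : Prop :=
  {within I, continuous phi} /\
  forall s, I s ->
    frame_comp E (c s) 0 0 = fq (c s) * cos (phi s) /\
    frame_comp E (c s) 0 1 = fq (c s) * sin (phi s).

End Finsleroid.

(* theta is a continuous branch on I of s |-> arctan (t s), where t is defined
   on I outside isolated points (its poles), D being its domain; at the poles
   the value of theta is determined by continuity. *)
Definition arctan_branch (R : realType) (I D : set R) (t theta : R -> R)
    : Prop :=
  {within I, continuous theta} /\
  forall s, I s -> D s -> exists k : int, theta s = atan (t s) + k%:~R * pi.

(* Main.v *)
Require Import Defs.
From mathcomp Require Import all_boot all_order all_algebra.
From mathcomp Require Import all_classical all_reals all_analysis.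
From mathcomp Require Import ring lra.

Set Implicit Arguments.
Unset Strict Implicit.
Unset Printing Implicit Defensive.

Import Order.TTheory GRing.Theory Num.Theory.
Import numFieldNormedType.Exports.

Local Open Scope classical_set_scope.
Local Open Scope ring_scope.

(** Fix [x], write [R1, R2, R3] for the frame components of [y], and map [y] to
    [N y = (h R1, h R2, A) / sqrt B], a unit vector because
    [B = A ^ 2 + h ^ 2 q ^ 2].  Its spherical coordinates are the colatitude
    [f = h chi] and the polar angle [phi].  The whole statement rests on one
    fact ([sphere_isometry], [metric_pullback]): on vectors tangent to the
    indicatrix,
      [g_ij v^i w^j = h ^ -2 <DN v, DN w>],
    so that [N] carries the indicatrix, away from the axis, to the unit sphere
    with its round metric divided by [h ^ 2].  It is a computation with
    [d chi = (b dq - q db) / B], which gives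
    [d (K ^ 2) = 2 T ((b + g q) db + q dq)] with [T = exp (- g chi)]; one more
    differentiation yields the Hessian of [K ^ 2 / 2].

    For a metric proportional to the one induced by an immersion [n] into a
    Euclidean space, the geodesic equation in any chart says that the
    acceleration of the image curve is normal to the surface
    ([geodesic_equation_normal]); besides the product rule this uses only the
    symmetry of the second derivatives of [n].  With [n] the composite of [N]
    and a chart, and [m = N (c)] of speed [h] by the choice of the parameter,
    being a geodesic means [m'' = - h ^ 2 m] ([geodesic_sphere_ode],
    [geodesic_of_accel]).

    Hence [m s = cos (h (s - s1)) v + sin (h (s - s1)) w] with orthonormal
    [v, w] ([harmonic_solution]).  Starting the parameter at the point of
    greatest height, every such great circle becomes
      [(ka cos al cos t - sin al sin t, ka sin al cos t + cos al sin t,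
        sqrt (1 - ka ^ 2) cos t)],  [t = h (s - s0)]
    ([great_circle_normal_form]), where [ka = h C] is the cosine of the
    inclination of its plane.  The third component is [cos (h chi)], and the
    first two say that [phi - al] is the polar angle of [(ka cos t, sin t)],
    that is, a branch of [arctan (tan t / ka)]; for [C = 0] the circle is a
    meridian and [phi] stays constant.

    Conversely, the two formulas determine [m] up to the sign of its horizontal
    part; a continuous branch keeps this sign on an interval
    ([circle_of_angle]), so [m] is a great circle run at speed [h].  The curve
    is then a geodesic in the chart with coordinates [f] and [phi]
    ([polar_chart]), in which it has the twice differentiable coordinates
    [acos (sqrt (1 - ka ^ 2) cos t)] and [phi]. *)

(** * Chain rule and local changes of a function *)

Section Chain.
Variable R : realType.

(** Only the outer function has to be differentiable: along the line through
    [x] directed by [v] the inner one is a derivable function of one variable. *)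
Lemma is_derive_chain (U V W : normedModType R) (g : U -> V) (f : V -> W)
    (x v : U) (dg : V) :
  is_derive x v g dg -> differentiable f (g x) ->
  is_derive x v (fun y => f (g y)) ('D_dg f (g x)).
Proof.
move=> [gd <-] fd; rewrite deriveE//.
have gd1 : derivable (fun t : R => g (t *: v + x)) 0 1 by move: gd => /derivable1P.
have gd2 := (derivable1_diffP _ _).1 gd1.
have e0 : g (0 *: v + x) = g x by rewrite scale0r add0r.
have fd' : differentiable f (g (0 *: v + x)) by rewrite e0.
have cd := differentiable_comp gd2 fd'.
have e1 (Z : normedModType R) (k : U -> Z) :
    'D_v k x = 'D_1 (fun t : R => k (t *: v + x)) 0.
  rewrite /derive; set g1 := fun h => h^-1 *: _; set g2 := fun h => h^-1 *: _.
  suff -> : g1 = g2 by []; apply/funext => t; rewrite /g1 /g2 /=.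
  by rewrite addr0 scale0r add0r [t%:A]mulr1.
apply: DeriveDef.
  apply: (derivable1P _ _ _).2; exact: (derivable1_diffP _ _).2 cd.
rewrite e1 (deriveE _ cd) (diff_comp gd2 fd')/= e0 e1; congr ('d f _ _).
by rewrite deriveE.
Qed.

Lemma derive_delta_sum (m : nat) (V : normedModType R) (f : 'rV[R]_m -> V) u v :
  differentiable f u -> 'D_v f u = \sum_a v 0 a *: partial a f u.
Proof.
move=> fd; rewrite deriveE// {1}[v]row_sum_delta linear_sum/=.
by apply: eq_bigr => a _; rewrite linearZ/= /partial deriveE.
Qed.

Lemma is_deriveR1 (U : normedModType R) (phi : R -> R) (f : U -> R) x v a df :
  is_derive (f x) 1 phi a -> is_derive x v f df ->
  is_derive x v (fun y => phi (f y)) (a * df).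
Proof.
move=> [pd <-] fd; have pd' := (derivable1_diffP _ _).1 pd.
apply: is_derive_eq (is_derive_chain fd pd') _.
by rewrite deriveE// diff1E// derive1E mulrC.
Qed.

Lemma differentiable_R1 (U : normedModType R) (phi : R -> R) (f : U -> R) x a :
  is_derive (f x) 1 phi a -> differentiable f x ->
  differentiable (fun y => phi (f y)) x.
Proof.
by move=> [pd _] fd; apply: (differentiable_comp fd); apply/derivable1_diffP.
Qed.

Lemma near_derive1 (V : normedModType R) (f g : R -> V) s :
  (\near s, f s = g s) -> derive1 f s = derive1 g s.
Proof. by move=> fg; rewrite !derive1E; apply: near_eq_derive. Qed.

Lemma differentiable_eps (U V : normedModType R) (f : U -> V) x :
  differentiable f x -> forall e, 0 < e ->
  \forall h \near 0, `|f (h + x) - f x - 'd f x h| <= e * `|h|.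
Proof.
move=> /diff_locally fE e e0.
have /eqaddoP/(_ _ e0) := fE.
by apply: filterS => h /=; rewrite !fctE/= opprD addrA.
Qed.

(** The remainder estimate at [x] only sees the values near [x]. *)
Lemma near_eq_differentiable (U V : normedModType R) (f g : U -> V) x :
  (\near x, f x = g x) -> differentiable f x -> differentiable g x.
Proof.
move=> fg fd; have fgx := nbhs_singleton fg.
have gE : g \o shift x = cst (g x) + 'd f x +o_ 0 id.
  apply/eqaddoP => e e0; have := differentiable_eps fd e0.
  have : \forall h \near 0, f (h + x) = g (h + x).
    by move: fg; rewrite (near_shift 0 x); apply: filterS => h /=; rewrite subr0.
  apply: filterS2 => h /= fgh.
  by rewrite !fctE/= -fgh -fgx opprD addrA.
have dE := diff_unique (diff_continuous fd) gE.
by apply/diff_locallyP; rewrite dE; split=> //; exact: diff_continuous.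
Qed.

End Chain.

(** * Twice differentiable functions *)

Section TwiceDiff.
Variable R : realType.


Lemma near_imp (T : topologicalType) (P Q : T -> Prop) (x : T) :
  (forall y, P y -> Q y) -> (\near x, P x) -> \near x, Q x.
Proof. by move=> PQ; exact: filterS. Qed.

Lemma near_all (T : topologicalType) (P : T -> Prop) (x : T) :
  (forall y, P y) -> \near x, P x.
Proof. exact: nearW. Qed.

Lemma near_imp2 (T : topologicalType) (P Q S : T -> Prop) (x : T) :
  (forall y, P y -> Q y -> S y) -> (\near x, P x) -> (\near x, Q x) ->
  \near x, S x.
Proof. by move=> PQ; exact: filterS2. Qed.

Lemma differentiable_coord_comp (U : normedModType R) (m n : nat)
    (f : U -> 'M[R]_(m, n)) x i j :
  differentiable f x -> differentiable (fun y => f y i j) x.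
Proof.
move=> fd; exact: (differentiable_comp fd (differentiable_coord (f x) i j)).
Qed.

Lemma differentiable_mulf (U : normedModType R) (f g : U -> R) x :
  differentiable f x -> differentiable g x ->
  differentiable (fun y => f y * g y) x.
Proof. exact: differentiableM. Qed.

Lemma differentiable_sumf (U : normedModType R) n (f : 'I_n -> U -> R) x :
  (forall i, differentiable (f i) x) ->
  differentiable (fun y => \sum_i f i y) x.
Proof.
move=> fd; rewrite (_ : (fun y => _) = \sum_i f i); first exact: differentiable_sum.
by apply/funext => y; rewrite fct_sumE.
Qed.

(** Differentiability of the first partial derivatives at the point itself is
    just what the symmetry of second derivatives requires, and it is stable
    under composition. *)
Definition twice_diff (m : nat) (V : normedModType R) (f : 'rV[R]_m -> V) u :=
  (\near u, differentiable f u) /\ forall a, differentiable (partial a f) u.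

Variable m : nat.
Implicit Types (f g : 'rV[R]_m -> R) (u : 'rV[R]_m).

Lemma twice_diff_continuous (V : normedModType R) (f : 'rV[R]_m -> V) u :
  twice_diff f u -> {for u, continuous f}.
Proof. by move=> [/nbhs_singleton fd _]; exact: differentiable_continuous. Qed.

Lemma twice_diff_cst (V : normedModType R) (c : V) u :
  twice_diff (fun _ : 'rV[R]_m => c) u.
Proof.
split=> [|a]; first by apply: near_all => y; exact: differentiable_cst.
rewrite (_ : partial a _ = cst 0); first exact: differentiable_cst.
by apply/funext => y; rewrite /partial derive_cst.
Qed.

Lemma twice_diffD f g u : twice_diff f u -> twice_diff g u ->
  twice_diff (fun y => f y + g y) u.
Proof.
move=> [fd fd2] [gd gd2]; split=> [|a].
  by apply: near_imp2 _ fd gd => y; exact: differentiableD.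
apply: (@near_eq_differentiable _ _ _ (fun y => partial a f y + partial a g y)).
  apply: near_imp2 _ fd gd => y fd gd.
  by rewrite [RHS]deriveD//; exact: diff_derivable.
exact: differentiableD.
Qed.

Lemma twice_diffM f g u : twice_diff f u -> twice_diff g u ->
  twice_diff (fun y => f y * g y) u.
Proof.
move=> [fd fd2] [gd gd2]; split=> [|a].
  by apply: near_imp2 _ fd gd => y; exact: differentiableM.
apply: (@near_eq_differentiable _ _ _
  (fun y => f y * partial a g y + g y * partial a f y)).
  apply: near_imp2 _ fd gd => y fd gd.
  by rewrite [RHS]deriveM//; exact: diff_derivable.
have {}fd := nbhs_singleton fd; have {}gd := nbhs_singleton gd.
by apply: differentiableD; exact: differentiable_mulf.
Qed.

Lemma twice_diffZ (c : R) f u : twice_diff f u ->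
  twice_diff (fun y => c * f y) u.
Proof. by move=> fd; apply: twice_diffM => //; exact: twice_diff_cst. Qed.

Lemma twice_diff_sum n (f : 'I_n -> 'rV[R]_m -> R) u :
  (forall i, twice_diff (f i) u) -> twice_diff (fun y => \sum_i f i y) u.
Proof.
elim: n f => [|n IH] f fd.
  rewrite (_ : (fun y => _) = fun=> 0); first exact: twice_diff_cst.
  by apply/funext => y; rewrite big_ord0.
rewrite (_ : (fun y => _) =
  fun y => f ord0 y + \sum_i f (lift ord0 i) y); last first.
  by apply/funext => y; rewrite big_ord_recl.
by apply: twice_diffD => //; apply: IH => i; exact: fd.
Qed.

Lemma twice_diff_R1 (phi dphi : R -> R) (ddphi : R) f u :
  (\forall t \near f u, is_derive (t : R) 1 phi (dphi t)) ->
  is_derive (f u) 1 dphi ddphi ->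
  twice_diff f u -> twice_diff (fun y => phi (f y)) u.
Proof.
move=> pd pd2 fd0; have fc := twice_diff_continuous fd0; case: fd0 => fd fd2.
have {}pd : \near u, is_derive (f u) 1 phi (dphi (f u)) by exact: fc pd.
split=> [|a].
  by apply: near_imp2 _ fd pd => y fd pd; exact: differentiable_R1 pd fd.
apply: (@near_eq_differentiable _ _ _ (fun y => dphi (f y) * partial a f y)).
  apply: near_imp2 _ fd pd => y fd pd.
  have /derivableP fda : derivable f y (delta_mx 0 a) by exact: diff_derivable.
  by have [_ <-] := is_deriveR1 pd fda.
apply: differentiable_mulf => //; apply: differentiable_R1 pd2 _.
exact: nbhs_singleton fd.
Qed.

Lemma partial_comp p (Y : 'rV[R]_m -> 'rV[R]_p) (f : 'rV[R]_p -> R) a u :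
  differentiable Y u -> differentiable f (Y u) ->
  partial a (fun y => f (Y y)) u =
  \sum_i partial a Y u 0 i * partial i f (Y u).
Proof.
move=> Yd fd.
have /derivableP Yda : derivable Y u (delta_mx 0 a) by exact: diff_derivable.
by rewrite {1}/partial; have [_ ->] := is_derive_chain Yda fd; rewrite derive_delta_sum.
Qed.

Lemma twice_diff_comp p (Y : 'rV[R]_m -> 'rV[R]_p) (f : 'rV[R]_p -> R) u :
  twice_diff Y u -> twice_diff f (Y u) -> twice_diff (fun y => f (Y y)) u.
Proof.
move=> Yd0; have Yc := twice_diff_continuous Yd0; case: Yd0 => Yd Yd2 [fd fd2].
have {}fd : \near u, differentiable f (Y u) by exact: Yc fd.
split=> [|a].
  by apply: near_imp2 _ fd Yd => y fd Yd; exact: (differentiable_comp Yd fd).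
apply: (@near_eq_differentiable _ _ _
    (fun y => \sum_i partial a Y y 0 i * partial i f (Y y))).
  by apply: near_imp2 _ fd Yd => y fd Yd; rewrite partial_comp.
apply: differentiable_sumf => i; apply: differentiable_mulf.
  exact: differentiable_coord_comp.
exact: (differentiable_comp (nbhs_singleton Yd) (fd2 i)).
Qed.

Lemma twice_diff_coord i u : twice_diff (fun y : 'rV[R]_m => y 0 i) u.
Proof.
split=> [|a]; first by apply: near_all => y; exact: differentiable_coord.
rewrite (_ : partial a _ = fun=> (delta_mx 0 a : 'rV[R]_m) 0 i).
  exact: differentiable_cst.
apply/funext => y; rewrite /partial.
have := derive_mx (@derivable_id R 'rV[R]_m y (delta_mx 0 a)).
by move=> /matrixP/(_ 0 i); rewrite mxE derive_id.
Qed.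

Lemma Ck2_twice_diff (V : normedModType R) (W : set 'rV[R]_m)
    (f : 'rV[R]_m -> V) u : open W -> Ck 2 W f -> W u -> twice_diff f u.
Proof.
move=> Wo [fd f2] Wu; split; first exact: (near_imp fd (open_nbhs_nbhs (conj Wo Wu))).
by move=> a; have [+ _] := f2 a; exact.
Qed.

End TwiceDiff.

(** * Symmetry of second derivatives *)

Section Schwarz.
Variables (R : realType) (V : normedModType R).

Lemma near0_norm (P : V -> Prop) : (\forall h \near 0, P h) ->
  exists2 d, 0 < d & forall h, `|h| < d -> P h.
Proof.
move=> /nbhs_ballP[d d0 dP]; exists d => // h hd; apply: dP.
by rewrite -ball_normE /= sub0r normrN.
Qed.

Lemma is_derive_line (f : V -> R) (a w : V) (s : R) :
  differentiable f (s *: a + w) ->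
  is_derive s 1 (fun r : R => f (r *: a + w)) ('D_a f (s *: a + w)).
Proof.
move=> fd.
have gd : is_derive s 1 (fun r : R => r *: a + w) a.
  have ad : is_derive s 1 (fun r : R => r *: a) a.
    have [ds dE] := is_diff_scalel s a.
    apply: DeriveDef; first exact/derivable1_diffP.
    by rewrite deriveE// dE/= scale1r.
  by rewrite -[X in is_derive _ _ _ X]addr0; exact: is_deriveD.
exact: is_derive_chain gd fd.
Qed.

(** The mean value theorem in the direction [a] turns the second difference into
    [t] times an increment of ['D_a f], which is [t * 'D_b ('D_a f) u] up to
    [o(t)] since ['D_a f] is differentiable at [u]. *)
Lemma second_difference (f : V -> R) (a b u : V) (e : R) :
  (\near u, differentiable f u) -> differentiable ('D_a f) u -> 0 < e ->
  exists2 d, 0 < d & forall t, 0 < t < d ->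
  `|f (t *: a + (t *: b + u)) - f (t *: a + u) - f (t *: b + u) + f u
    - t ^+ 2 * 'D_b ('D_a f) u| <= e * t ^+ 2.
Proof.
move=> fd gd e0; set g := 'D_a f in gd *.
(* the two points compared lie within [t * (|a| + |b|)] of [u] *)
pose k := 2 * (`|a| + `|b|) + 1.
have k0 : 0 < k by rewrite /k ltr_pwDr ?ltr01// mulr_ge0// addr_ge0.
have ke0 : 0 < e / k by rewrite divr_gt0.
have [d1 d10 gE] := near0_norm (differentiable_eps gd ke0).
have [d2 d20 fE] : exists2 d, 0 < d & forall h, `|h| < d ->
    differentiable f (h + u).
  apply: near0_norm; move: fd; rewrite (near_shift 0 u).
  by apply: filterS => h /=; rewrite subr0.
pose d := Num.min d1 d2; have d0 : 0 < d by rewrite /d lt_min d10.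
exists (d / k); first by rewrite divr_gt0.
move=> t /andP[t0 tk].
have small s r : 0 <= s <= t -> 0 <= r <= t ->
    `|s *: a + r *: b| <= t * (`|a| + `|b|) /\ `|s *: a + r *: b| < d.
  move=> /andP[s0 st] /andP[r0 rt].
  have le1 : `|s *: a + r *: b| <= t * (`|a| + `|b|).
    rewrite (le_trans (ler_normD _ _))// !normrZ !ger0_norm// mulrDr.
    by rewrite lerD// ler_wpM2r.
  split=> //; apply: le_lt_trans le1 _.
  move: tk; rewrite ltr_pdivlMr// => /(le_lt_trans _); apply.
  by rewrite ler_wpM2l// ?ltW// /k; have := normr_ge0 a; have := normr_ge0 b; lra.
have tt : 0 <= t <= t by rewrite lexx (ltW t0).
have t00 : 0 <= (0 : R) <= t by rewrite lexx (ltW t0).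
pose psi s := f (s *: a + (t *: b + u)) - f (s *: a + u).
have psid s : 0 <= s <= t ->
    is_derive s 1 psi (g (s *: a + (t *: b + u)) - g (s *: a + u)).
  move=> st; apply: is_deriveB; apply: is_derive_line.
    by rewrite addrA; apply: fE; have [] := small s t st tt; rewrite /d lt_min => _ /andP[].
  have [] := small s 0 st t00.
  by rewrite scale0r addr0 /d lt_min => _ /andP[_ ?]; apply: fE.
have [||s] := @MVT R psi
  (fun s => g (s *: a + (t *: b + u)) - g (s *: a + u)) 0 t t0.
- by move=> s; rewrite in_itv/= => /andP[/ltW ? /ltW ?]; apply: psid; apply/andP.
- apply: derivable_within_continuous => s; rewrite in_itv/= => st.
  by have [] := psid s st.
rewrite in_itv/= subr0 => /andP[/ltW s0 /ltW st].
have {}st : 0 <= s <= t by rewrite s0.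
rewrite {1 2}/psi !scale0r !add0r => psiE.
rewrite (_ : _ + f u = f (t *: a + (t *: b + u)) - f (t *: a + u)
  - (f (t *: b + u) - f u)); last by ring.
rewrite psiE.
have [n1 /lt_le_trans n1'] := small s t st tt.
have [n2 /lt_le_trans n2'] := small s 0 st t00.
have m1 : d <= d1 by rewrite /d ge_min lexx.
pose L v : R := 'd g u v.
have LD v w : L (v + w) = L v + L w by rewrite /L linearD.
have LZ r v : L (r *: v) = r * L v by rewrite /L linearZZ.
have E1 : `|g (s *: a + (t *: b + u)) - g u - (s * L a + t * L b)| <=
    e / k * `|s *: a + t *: b|.
  by have := gE _ (n1' _ m1); rewrite -/(L _) LD !LZ -(addrA (s *: a)).
have E2 : `|g (s *: a + u) - g u - s * L a| <= e / k * `|s *: a + 0 *: b|.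
  have := gE _ (n2' _ m1); rewrite scale0r addr0.
  by rewrite -/(L _) LZ.
rewrite (_ : 'D_b g u = L b); last exact: deriveE.
rewrite (_ : _ - _ = t * ((g (s *: a + (t *: b + u)) - g u -
  (s * L a + t * L b)) - (g (s *: a + u) - g u - s * L a))); last by ring.
rewrite normrM (gtr0_norm t0) expr2 mulrCA ler_pM2l//.
apply: le_trans (ler_normB _ _) _.
apply: le_trans (lerD E1 E2) _.
rewrite -mulrDr -mulrA ler_pM2l// mulrC ler_pdivrMr//.
apply: le_trans (lerD n1 n2) _.
by rewrite -mulrDr ler_pM2l// /k; lra.
Qed.

(** The second difference is symmetric in [a] and [b], so its two expansions
    have the same leading coefficient. *)
Lemma second_derive_sym (f : V -> R) (a b u : V) :
  (\near u, differentiable f u) ->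
  differentiable ('D_a f) u -> differentiable ('D_b f) u ->
  'D_b ('D_a f) u = 'D_a ('D_b f) u.
Proof.
move=> fd ad bd; apply/eqP; rewrite -subr_eq0 -normr_le0.
apply/ler_addgt0Pr => e e0; rewrite add0r.
have e20 : 0 < e / 2 by rewrite divr_gt0.
have [d1 d10 E1] := second_difference b fd ad e20.
have [d2 d20 E2] := second_difference a fd bd e20.
pose t := Num.min d1 d2 / 2.
have m0 : 0 < Num.min d1 d2 by rewrite lt_min d10.
have t0 : 0 < t by rewrite divr_gt0.
have td : t < Num.min d1 d2 by rewrite /t; lra.
move: td; rewrite lt_min => /andP[t1 t2].
have {}E1 := E1 t; have {}E2 := E2 t; rewrite t0 t1 in E1; rewrite t0 t2 in E2.
move: (E1 isT) (E2 isT) => {E1 E2}.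
set A := 'D_b _ u; set B := 'D_a _ u.
rewrite [t *: b + (t *: a + u)]addrCA => E1 E2.
have t20 : 0 < t ^+ 2 by rewrite exprn_gt0.
rewrite -(ler_pM2l t20) -[X in X * `|_|](gtr0_norm t20) -normrM.
rewrite (_ : t ^+ 2 * (A - B) =
  (f (t *: a + (t *: b + u)) - f (t *: b + u) - f (t *: a + u) + f u - t ^+ 2 * B)
  - (f (t *: a + (t *: b + u)) - f (t *: a + u) - f (t *: b + u) + f u
    - t ^+ 2 * A)); last by ring.
apply: le_trans (ler_normB _ _) _.
apply: le_trans (lerD E2 E1) _.
by rewrite -mulrDl -splitr mulrC.
Qed.

End Schwarz.

(** * Geodesics of an induced metric *)

Section GeodesicNormal.
Variables (R : realType).

Lemma is_derive_coord (m p : nat) (V : normedModType R) (M : V -> 'M[R]_(m, p))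
    x v dM i j :
  is_derive x v M dM -> is_derive x v (fun y => M y i j) (dM i j).
Proof.
move=> [Md <-]; apply: DeriveDef; first exact: (derivable_mxP _ _ _).1 Md i j.
by rewrite derive_mx// mxE.
Qed.

Lemma is_derive1P (V : normedModType R) (f : R -> V) s :
  derivable f s 1 -> is_derive s 1 f (derive1 f s).
Proof. by move=> fd; rewrite derive1E; exact: derivableP. Qed.

Lemma is_derive1_along (m : nat) (f : 'rV[R]_m -> R) (u : R -> 'rV[R]_m) s :
  derivable u s 1 -> differentiable f (u s) ->
  is_derive s 1 (fun t => f (u t))
    (\sum_a derive1 u s 0 a * partial a f (u s)).
Proof.
move=> /is_derive1P ud fd.
by apply: is_derive_eq (is_derive_chain ud fd) _; rewrite derive_delta_sum.
Qed.

Lemma is_derive_sumf n (V : normedModType R) (f : 'I_n -> V -> R) x v df :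
  (forall i, is_derive x v (f i) (df i)) ->
  is_derive x v (fun y => \sum_i f i y) (\sum_i df i).
Proof.
move=> fd; rewrite (_ : (fun y => _) = \sum_i f i); last first.
  by apply/funext => y; rewrite fct_sumE.
exact: is_derive_sum.
Qed.

Lemma is_derive_mulf (V : normedModType R) (f g : V -> R) x v df dg :
  is_derive x v f df -> is_derive x v g dg ->
  is_derive x v (fun y => f y * g y) (f x * dg + g x * df).
Proof. by move=> fd gd; exact: is_deriveM. Qed.

Variables (p : nat) (n : 'I_p -> 'rV[R]_2 -> R).

Definition gram (v : 'rV[R]_2) : 'M[R]_2 :=
  \matrix_(a, b) \sum_k partial a (n k) v * partial b (n k) v.

(** The scalar product of the acceleration of the image curve [n (u t)] with the
    [d]-th coordinate vector of the image surface. *)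
Definition normal_accel (u : R -> 'rV[R]_2) (s : R) (d : 'I_2) : R :=
  \sum_k partial d (n k) (u s) * derive1 (derive1 (fun t => n k (u t))) s.

Variables (gamma : 'rV[R]_2 -> 'M[R]_2) (lam : R) (u : R -> 'rV[R]_2) (s : R).
Hypothesis n_twice : forall k, twice_diff (n k) (u s).
Hypothesis gammaE : \forall v \near u s, gamma v = lam *: gram v.
Hypothesis lam0 : lam != 0.
Hypothesis gamma_unit : gamma (u s) \in unitmx.
Hypothesis u_derivable : \near s, derivable u s 1.
Hypothesis u_derivable2 : derivable (derive1 u) s 1.

(** The first and second derivatives enter through their values [dn], [d2n],
    [du], [d2u]: the algebra below never looks inside a derivative. *)
Variables (dn : 'I_p -> 'I_2 -> R) (d2n : 'I_p -> 'I_2 -> 'I_2 -> R).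
Variables (du d2u : 'rV[R]_2).
Hypothesis dnE : forall k a, partial a (n k) (u s) = dn k a.
Hypothesis d2nE : forall k a b, partial a (partial b (n k)) (u s) = d2n k a b.
Hypothesis duE : derive1 u s = du.
Hypothesis d2uE : derive1 (derive1 u) s = d2u.


Lemma is_derive2_along k :
  is_derive s 1 (derive1 (fun t => n k (u t)))
   (\sum_a (du 0 a * (\sum_b du 0 b * d2n k b a)
            + dn k a * d2u 0 a)).
Proof.
have [nd nd2] := n_twice k.
have ud : derivable u s 1 := nbhs_singleton u_derivable.
have uc : {for s, continuous u}.
  by apply: differentiable_continuous; apply/derivable1_diffP.
have E : \forall t \near s, \sum_a derive1 u t 0 a * partial a (n k) (u t)
    = derive1 (fun t => n k (u t)) t.
  apply: near_imp2 u_derivable (uc _ nd) => t ut nt.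
  by have [_ <-] := is_derive1_along ut nt; rewrite derive1E.
apply: near_eq_is_derive E _.
apply: is_derive_sumf => a; rewrite -duE -dnE -d2uE.
apply: is_derive_mulf; first exact: is_derive_coord (is_derive1P u_derivable2).
apply: is_derive_eq (is_derive1_along ud (nd2 a)) _.
by apply: eq_bigr => b _; rewrite d2nE.
Qed.

Lemma d2n_sym k a b : d2n k a b = d2n k b a.
Proof.
have [nd nd2] := n_twice k; rewrite -!d2nE.
exact: (second_derive_sym nd (nd2 b) (nd2 a)).
Qed.

Lemma partial_gamma a b c :
  partial a (fun v => gamma v b c : R^o) (u s) =
  lam * \sum_k (dn k b * d2n k a c
                + dn k c * d2n k a b).
Proof.
have E : \forall v \near u s,
    lam * \sum_k partial b (n k) v * partial c (n k) v = gamma v b c.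
  by apply: near_imp gammaE => v ->; rewrite !mxE.
rewrite /partial -(near_eq_derive _ E).
suff : is_derive (u s) (delta_mx 0 a)
  (fun v => lam * \sum_k partial b (n k) v * partial c (n k) v)
  (lam * \sum_k (dn k b * d2n k a c
                + dn k c * d2n k a b)) by case.
have := is_derive_mulf (is_derive_cst lam (u s) (delta_mx 0 a)) _.
move=> H; apply: is_derive_eq (H _ _ _) _; last by rewrite mulr0 addr0.
apply: is_derive_sumf => k; have [_ nd2] := n_twice k.
rewrite -!d2nE -!dnE.
by apply: is_derive_mulf; apply: derivableP; exact: diff_derivable.
Qed.

(** Koszul's computation: when the metric is [lam <dn, dn>], the three
    derivatives of its coefficients combine into
    [2 lam <d_d n, d_b d_c n>], by symmetry of the second derivatives. *)
Lemma christoffelE a b c : christoffel gamma (u s) a b c =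
  \sum_d invmx (gamma (u s)) a d *
     (lam * \sum_k dn k d * d2n k b c).
Proof.
rewrite /christoffel mulr_sumr; apply: eq_bigr => d _.
rewrite mulrCA; congr (_ * _).
rewrite !partial_gamma -!mulrDr -mulrBr mulrCA; congr (_ * _).
rewrite -big_split/= -sumrB mulr_sumr; apply: eq_bigr => k _.
by rewrite (d2n_sym k c b) (d2n_sym k b d) (d2n_sym k c d); field.
Qed.

(** Lowering the index of the geodesic equation with [gamma] turns its left-hand
    side into [lam] times the tangential part of the acceleration. *)
Lemma geodesic_equation_normal :
  geodesic_equation gamma u s <-> forall d, normal_accel u s d = 0.
Proof.
have ud : derivable u s 1 := nbhs_singleton u_derivable.
pose E : 'cV[R]_2 := \col_a (d2u 0 a
  + \sum_(b < 2) \sum_(c < 2) christoffel gamma (u s) a b c * du 0 b * du 0 c).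
pose Q : 'cV[R]_2 := \col_d (lam * \sum_k dn k d *
   \sum_(b < 2) \sum_(c < 2) d2n k b c * du 0 b * du 0 c).
have EE : E = d2u^T + invmx (gamma (u s)) *m Q.
  apply/matrixP => a j; rewrite (ord1 j) !mxE; congr (_ + _).
  under eq_bigr do under eq_bigr do rewrite christoffelE -mulrA mulr_suml.
  under eq_bigr do rewrite exchange_big/=.
  rewrite exchange_big/=; apply: eq_bigr => d _; rewrite mxE.
  under eq_bigr do under eq_bigr do rewrite -!mulrA.
  under eq_bigr do rewrite -!mulr_sumr.
  rewrite -!mulr_sumr; congr (_ * (_ * _)).
  under eq_bigr do under eq_bigr do rewrite mulr_suml.
  under eq_bigr do rewrite exchange_big/=.
  rewrite exchange_big/=; apply: eq_bigr => k _.
  rewrite mulr_sumr; apply: eq_bigr => b _.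
  by rewrite mulr_sumr; apply: eq_bigr => c _; rewrite !mulrA.
have gE : gamma (u s) *m E = lam *: \col_d normal_accel u s d.
  rewrite EE mulmxDr mulmxA mulmxV// mul1mx (nbhs_singleton gammaE).
  apply/matrixP => d j; rewrite (ord1 j) !mxE.
  under eq_bigr do rewrite !mxE -mulrA mulr_suml.
  rewrite -mulr_sumr -mulrDr; congr (_ * _).
  rewrite exchange_big/= -big_split/=; apply: eq_bigr => k _.
  have [_ dE] := is_derive2_along k; rewrite [in RHS]derive1E dE dnE.
  under eq_bigr do rewrite dnE.
  rewrite big_split/= mulrDr addrC; congr (_ + _).
    congr (_ * _).
    rewrite exchange_big/=; apply: eq_bigr => b _.
    by rewrite mulr_sumr; apply: eq_bigr => c _; ring.
  by rewrite mulr_sumr; apply: eq_bigr => a _; rewrite mulrA.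
rewrite /geodesic_equation d2uE duE; split=> [[_ _ eq0] d|eq0].
  have E0 : E = 0 by apply/matrixP => a j; rewrite !mxE eq0.
  move: gE; rewrite E0 mulmx0 => /matrixP/(_ d 0); rewrite !mxE => /esym/eqP.
  by rewrite mulf_eq0 (negPf lam0)/= => /eqP.
split=> // a.
have : E = 0.
  rewrite -[E](mulKmx gamma_unit) gE (_ : \col_d _ = 0) ?scaler0 ?mulmx0//.
  by apply/matrixP => d j; rewrite !mxE eq0.
by move=> /matrixP/(_ a 0); rewrite !mxE.
Qed.

End GeodesicNormal.

(** * An adapted frame of the tangent space *)

Section Frame.
Variables (R : realType) (F : finsleroid_space R) (x : 'rV[R]_3).
Hypothesis hx : dom F x.
Variable (E : 'M[R]_3).
Hypothesis hE : adapted_frame F x E.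
Implicit Types y v w : 'rV[R]_3.

Local Notation g := (fg F x).
Local Notation h := (fh F x).
Local Notation q := (fq F x).
Local Notation fr k y := (frame_comp E y 0 k).

Lemma fh2 : h ^+ 2 = 1 - g ^+ 2 / 4.
Proof.
have /andP[g1 g2] := fg_bound hx.
by rewrite sqr_sqrtr//; nra.
Qed.

Lemma fh_gt0 : 0 < h.
Proof. by have /andP[g1 g2] := fg_bound hx; rewrite sqrtr_gt0; nra. Qed.

Lemma frame_unit : E \in unitmx.
Proof. by have [+ _] := hE; rewrite -mulmxA => /mulmx1_unit[]. Qed.

Lemma frame_compK y : frame_comp E y *m E = y.
Proof. by rewrite /frame_comp mulmxKV// frame_unit. Qed.

(** The third frame vector is the dual of [b], hence the third component is the
    form [b] itself. *)
Lemma b_form_frame y : b_form F x y = fr ord_max y.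
Proof.
have [E1 E2] := hE.
have invE : invmx E = fa F x *m E^T.
  have := E1; rewrite -mulmxA => E1'.
  by rewrite -[RHS](mulKmx frame_unit) E1' mulmx1.
have au : fa F x \in unitmx.
  have : fa F x *m E^T \in unitmx by rewrite -invE unitmx_inv frame_unit.
  by rewrite unitmx_mul => /andP[].
have bE : b_up F x *m fa F x = fb F x.
  rewrite (_ : b_up F x = fb F x *m (invmx (fa F x))^T).
    by rewrite trmx_inv fa_sym// mulmxKV.
  by apply/matrixP => i j; rewrite (ord1 i) !mxE; apply: eq_bigr => k _; rewrite !mxE mulrC.
rewrite /frame_comp invE mulmxA /b_form.
transitivity ((y *m (b_up F x *m fa F x)^T) 0 0).
  by rewrite bE mxE; apply: eq_bigr => i _; rewrite mxE mulrC.
rewrite trmx_mul fa_sym// mulmxA -E2 mxE [RHS]mxE.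
by apply: eq_bigr => i _; rewrite !mxE.
Qed.

(** The frame being orthonormal, [a_ij y^i y^j] is the sum of the squares of
    the components, and subtracting [b ^ 2] leaves the first two. *)
Lemma fq_frame y : q y = Num.sqrt (fr 0 y ^+ 2 + fr 1 y ^+ 2).
Proof.
have [E1 E2] := hE; congr Num.sqrt.
have yE : \sum_(m < 3) \sum_(n < 3) fa F x m n * y 0 m * y 0 n =
    \sum_k fr k y ^+ 2.
  transitivity ((y *m fa F x *m y^T) 0 0).
    rewrite mxE exchange_big/=; apply: eq_bigr => n _; rewrite !mxE mulr_suml.
    by apply: eq_bigr => m _; rewrite [y 0 m * _]mulrC.
  have : y = frame_comp E y *m E by rewrite frame_compK.
  move: (frame_comp E y) => r ->.
  rewrite trmx_mul -!mulmxA (mulmxA E) (mulmxA (E *m _)) E1 mul1mx mxE.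
  by apply: eq_bigr => k _; rewrite mxE expr2.
transitivity (\sum_(m < 3) \sum_(n < 3) fa F x m n * y 0 m * y 0 n -
    b_form F x y ^+ 2).
  rewrite expr2 {2}/b_form mulr_sumr -sumrB; apply: eq_bigr => m _.
  rewrite {1}/b_form mulr_suml -sumrB; apply: eq_bigr => n _.
  by ring.
rewrite yE b_form_frame !big_ord_recr big_ord0/= add0r addrK.
by congr (fr _ _ ^+ 2 + fr _ _ ^+ 2); apply/val_inj.
Qed.

End Frame.

(** * The Finsler metric tensor *)

Section IsDiff.
Variables (R : realType) (V : normedModType R).
Implicit Types (f : V -> R) (x v : V).

Lemma is_diff_mulf f (g : V -> R) x df dg : is_diff x f df -> is_diff x g dg ->
  is_diff x (fun z => f z * g z) (fun v => f x * dg v + g x * df v).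
Proof. by move=> fd gd; exact: is_diffM. Qed.

Lemma is_diff_addf f (g : V -> R) x df dg : is_diff x f df -> is_diff x g dg ->
  is_diff x (fun z => f z + g z) (fun v => df v + dg v).
Proof. by move=> fd gd; exact: is_diffD. Qed.

Lemma is_diff_scalef c f x df : is_diff x f df ->
  is_diff x (fun z => c * f z) (fun v => c * df v).
Proof. by move=> fd; exact: is_diffZ. Qed.

Lemma is_diff_derive f x v df : is_diff x f df -> is_derive x v f (df v).
Proof.
move=> [fd <-]; apply: DeriveDef; first exact: diff_derivable.
by rewrite deriveE.
Qed.

Lemma is_diff_of_derive f x df : differentiable f x ->
  (forall v, is_derive x v f (df v)) -> is_diff x f df.
Proof.
move=> fd fdf; apply: DiffDef => //; apply/funext => v.
by rewrite -deriveE//; have [_ ->] := fdf v.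
Qed.

Lemma is_diff_R1 (phi : R -> R) f x a df :
  is_derive (f x) 1 phi a -> is_diff x f df ->
  is_diff x (fun z => phi (f z)) (fun v => a * df v).
Proof.
move=> pd fd; apply: is_diff_of_derive.
  by apply: differentiable_R1 pd _; case: fd.
by move=> v; apply: is_deriveR1 pd _; exact: is_diff_derive.
Qed.

Lemma is_derive_invR (s : R) : s != 0 -> is_derive s 1 (@GRing.inv R) (- s ^- 2).
Proof.
move=> s0; apply: is_derive_eq (is_deriveV s0 (is_derive_id s 1)) _.
by rewrite scaler1.
Qed.

End IsDiff.

Section Metric.
Variables (R : realType) (F : finsleroid_space R) (x : 'rV[R]_3).
Hypothesis hx : dom F x.
Variable (E : 'M[R]_3).
Hypothesis hE : adapted_frame F x E.
Implicit Types y v w : 'rV[R]_3.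

Local Notation g := (fg F x).
Local Notation h := (fh F x).
Local Notation q := (fq F x).
Local Notation b := (b_form F x).
Local Notation A := (fA F x).
Local Notation B := (fB F x).
Local Notation fr k y := (frame_comp E y 0 k).

Definition horizontal_dot v w : R := fr 0 v * fr 0 w + fr 1 v * fr 1 w.
Definition diff_fq y v : R := horizontal_dot y v / q y.
Definition diff_fA y v : R := b v + 2^-1 * g * diff_fq y v.
Definition diff_fB y v : R := 2 * (b y * b v) + g * (b v * q y + b y * diff_fq y v)
  + 2 * (q y * diff_fq y v).
Definition diff_chi y v : R := (b y * diff_fq y v - q y * b v) / B y.
Definition conformal_factor y : R := expR (- (g * chi F x y)).
(** Up to the factor [2 T], the differential of [K ^ 2] at [y]. *)
Definition conormal y v : R := (b y + g * q y) * b v + horizontal_dot y v.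

Lemma is_diff_frame k y : is_diff y (fun z => fr k z) (fun v => fr k v).
Proof.
rewrite (_ : (fun z => _) = fun z : 'rV_3 => \sum_i z 0 i * invmx E i k); last first.
  by apply/funext => z; rewrite mxE.
apply: is_diff_of_derive.
  apply: differentiable_sumf => i; apply: differentiable_mulf.
    exact: differentiable_coord.
  exact: differentiable_cst.
move=> v; apply: is_derive_sumf => i.
apply: is_derive_eq (is_derive_mulf (is_derive_coord 0 i (is_derive_id y v))
  (is_derive_cst (invmx E i k) y v)) _.
by rewrite mulr0 add0r mulrC.
Qed.

Lemma is_diff_b y : is_diff y b b.
Proof.
have -> : b = fun z => fr ord_max z by apply/funext => z; exact: (b_form_frame hx hE).
exact: is_diff_frame.
Qed.

Lemma fq_ge0 y : 0 <= q y. Proof. exact: sqrtr_ge0. Qed.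

Lemma horizontal_dot_diag y : horizontal_dot y y = q y ^+ 2.
Proof.
by rewrite (fq_frame hx hE) sqr_sqrtr /horizontal_dot -?expr2// addr_ge0// sqr_ge0.
Qed.

Lemma is_diff_horizontal_dotl w y :
  is_diff y (fun z => horizontal_dot z w) (fun v => horizontal_dot v w).
Proof.
rewrite /horizontal_dot; apply: is_diff_addf.
  have := is_diff_scalef (fr 0 w) (is_diff_frame 0 y).
  by under eq_fun do rewrite mulrC; move=> /is_diff_eq; apply;
    apply/funext => v; rewrite mulrC.
have := is_diff_scalef (fr 1 w) (is_diff_frame 1 y).
by under eq_fun do rewrite mulrC; move=> /is_diff_eq; apply;
  apply/funext => v; rewrite mulrC.
Qed.

Lemma is_diff_q y : q y != 0 -> is_diff y q (diff_fq y).
Proof.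
move=> q0.
have qE : q = fun z => Num.sqrt (horizontal_dot z z).
  by apply/funext => z; rewrite horizontal_dot_diag sqrtr_sqr ger0_norm ?fq_ge0.
have d0 : 0 < horizontal_dot y y by rewrite horizontal_dot_diag exprn_even_gt0.
have dd : is_diff y (fun z => horizontal_dot z z) (fun v => 2 * horizontal_dot y v).
  have d k := is_diff_mulf (is_diff_frame k y) (is_diff_frame k y).
  apply: is_diff_eq (is_diff_addf (d 0) (d 1)) _.
  by apply/funext => v; rewrite /horizontal_dot; ring.
have := is_diff_R1 (f := fun z => horizontal_dot z z) (is_derive1_sqrt d0) dd.
rewrite -qE => /is_diff_eq; apply; apply/funext => v.
rewrite horizontal_dot_diag sqrtr_sqr ger0_norm ?fq_ge0// /diff_fq.
by move: (horizontal_dot y v) (q y) q0 => d r r0; field.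
Qed.

Lemma is_diff_A y : q y != 0 -> is_diff y A (diff_fA y).
Proof.
move=> q0; have qd := is_diff_q q0; have bd := is_diff_b y.
by have := is_diff_addf bd (is_diff_scalef (2^-1 * g) qd).
Qed.

Lemma is_diff_B y : q y != 0 -> is_diff y B (diff_fB y).
Proof.
move=> q0; have qd := is_diff_q q0; have bd := is_diff_b y.
have d := is_diff_addf (is_diff_addf (is_diff_mulf bd bd)
  (is_diff_mulf (is_diff_scalef g bd) qd)) (is_diff_mulf qd qd).
apply: is_diff_eq d _; apply/funext => v; rewrite /diff_fB.
move: (diff_fq y v) (b y) (b v) (q y) => *; ring.
Qed.

(** This decomposition makes [A / sqrt B] and [h q / sqrt B] the cosine and the
    sine of the angle [f]. *)
Lemma fBE y : B y = A y ^+ 2 + h ^+ 2 * q y ^+ 2.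
Proof. by rewrite (fh2 hx) /fB /fA; field. Qed.

Lemma fB_gt0 y : q y != 0 -> 0 < B y.
Proof.
move=> q0; rewrite fBE ltr_wpDl ?sqr_ge0// -exprMn exprn_even_gt0//= mulf_neq0//.
by rewrite gt_eqF// (fh_gt0 hx).
Qed.

Lemma fB_ge0 y : 0 <= B y.
Proof. by rewrite fBE -exprMn addr_ge0// sqr_ge0. Qed.

Lemma sqrt_sub_cos y : q y != 0 ->
  Num.sqrt (1 - (A y / Num.sqrt (B y)) ^+ 2) = h * q y / Num.sqrt (B y).
Proof.
move=> q0; have B0 := fB_gt0 q0.
have s0 : 0 < Num.sqrt (B y) by rewrite sqrtr_gt0.
have s2 : Num.sqrt (B y) ^+ 2 = B y by rewrite sqr_sqrtr// ltW.
have u2 : (A y / Num.sqrt (B y)) ^+ 2 = 1 - (h * q y / Num.sqrt (B y)) ^+ 2.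
  have := fBE y; rewrite !expr_div_n s2 exprMn.
  move: (A y) (B y) (q y) B0 => a b' r b0 bE.
  have -> : a ^+ 2 = b' - h ^+ 2 * r ^+ 2 by rewrite bE addrK.
  by field; rewrite gt_eqF.
rewrite u2 subKr sqrtr_sqr ger0_norm// divr_ge0 ?(ltW s0)// mulr_ge0 ?fq_ge0//.
by rewrite ltW// (fh_gt0 hx).
Qed.

Lemma cos_bound y : q y != 0 -> -1 < A y / Num.sqrt (B y) < 1.
Proof.
move=> q0; have B0 := fB_gt0 q0.
have s0 : 0 < Num.sqrt (B y) by rewrite sqrtr_gt0.
have : 0 < Num.sqrt (1 - (A y / Num.sqrt (B y)) ^+ 2).
  rewrite sqrt_sub_cos// divr_gt0// mulr_gt0 ?(fh_gt0 hx)//.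
  by rewrite lt_def q0 fq_ge0.
rewrite sqrtr_gt0; move: (A y / _) => u u2.
by apply/andP; split; rewrite ltNge; apply/negP => u1; nra.
Qed.

(** The numerator of the derivative of [A / sqrt B]; that it is divisible by
    [h ^ 2 q] is what makes the differential of [chi] so simple. *)
Lemma dcos_chi y v : diff_fA y v * B y - A y * diff_fB y v / 2 =
  - (h ^+ 2 * q y * (b y * diff_fq y v - q y * b v)).
Proof.
rewrite (fh2 hx) /diff_fA /diff_fB /fA /fB.
by move: (b y) (b v) (q y) (diff_fq y v) => *; field.
Qed.

Lemma is_diff_chi y : q y != 0 -> is_diff y (chi F x) (diff_chi y).
Proof.
move=> q0; have B0 := fB_gt0 q0.
have s0 : 0 < Num.sqrt (B y) by rewrite sqrtr_gt0.
have s2 : Num.sqrt (B y) ^+ 2 = B y by rewrite sqr_sqrtr// ltW.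
have h0 := fh_gt0 hx.
have sd := is_diff_R1 (f := B) (is_derive1_sqrt B0) (is_diff_B q0).
have invd := is_diff_R1 (f := fun z => Num.sqrt (B z))
  (is_derive_invR (lt0r_neq0 s0)) sd.
have ad := is_diff_R1 (f := fun z => A z / Num.sqrt (B z))
  (is_derive1_acos (cos_bound q0))
  (is_diff_mulf (is_diff_A q0) invd).
have := is_diff_scalef h^-1 ad.
rewrite (_ : (fun z => h^-1 * _) = chi F x); last first.
  by apply/funext => z; rewrite /chi mulrC.
move=> /is_diff_eq; apply; apply/funext => v.
rewrite sqrt_sub_cos// /diff_chi; have := dcos_chi y v.
move: (Num.sqrt (B y)) s0 s2 => s s0 <-.
move: (b y * diff_fq y v - q y * b v) => d.
move: (diff_fA y v) (A y) (diff_fB y v) (q y) q0 => a' a b' r r0 E1.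
have {E1}-> : d = - (a' * s ^+ 2 - a * b' / 2) / (h ^+ 2 * r).
  by rewrite E1; field; rewrite r0 gt_eqF.
by field; rewrite r0 !gt_eqF.
Qed.

Lemma is_diff_conformal_factor y : q y != 0 ->
  is_diff y conformal_factor (fun v => - (g * diff_chi y v) * conformal_factor y).
Proof.
move=> q0; have d := is_diff_R1 (f := fun z => - g * chi F x z)
  (is_derive_expR (- g * chi F x y))
  (is_diff_scalef (- g) (is_diff_chi q0)).
have -> : conformal_factor = fun z => expR (- g * chi F x z).
  by apply/funext => z; rewrite /conformal_factor mulNr.
by apply: is_diff_eq d _; apply/funext => v; rewrite mulrC mulNr.
Qed.

Lemma finsler_K2 y : finsler_K F x y ^+ 2 = B y * conformal_factor y.
Proof.
rewrite /finsler_K exprMn sqr_sqrtr ?fB_ge0// /conformal_factor -expRM_natl.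
by congr (_ * expR _); rewrite mulr_natl; field.
Qed.

(** The terms of [dB] and of [- g B dchi] in [b dq] cancel and those in [q db]
    add up, which leaves [2 (b + g q) db + 2 q dq]. *)
Lemma is_diff_K2 y : q y != 0 ->
  is_diff y (fun z => finsler_K F x z ^+ 2) (fun v => 2 * (conformal_factor y * conormal y v)).
Proof.
move=> q0; have -> : (fun z => finsler_K F x z ^+ 2) = fun z => B z * conformal_factor z.
  by apply/funext => z; exact: finsler_K2.
apply: is_diff_eq (is_diff_mulf (is_diff_B q0) (is_diff_conformal_factor q0)) _.
apply/funext => v; have B0 := fB_gt0 q0.
have -> : B y * (- (g * diff_chi y v) * conformal_factor y) =
    - (g * (b y * diff_fq y v - q y * b v)) * conformal_factor y.
  rewrite /diff_chi; move: (b y * _ - _) (B y) (conformal_factor y) B0 => d a c a0.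
  by field; rewrite gt_eqF.
have : q y * diff_fq y v = horizontal_dot y v by rewrite /diff_fq mulrC divfK.
rewrite /diff_fB /conormal => <-.
by move: (b y) (b v) (q y) (diff_fq y v) (conformal_factor y) => *; ring.
Qed.

Lemma near_fq y : q y != 0 -> \near y, q y != 0.
Proof.
move=> q0; have qc : {for y, continuous q}.
  by apply: differentiable_continuous; have [] := is_diff_q q0.
exact: (qc _ (open_nbhs_nbhs (conj (open_neq (y := 0)) q0))).
Qed.

(** The Hessian of [K ^ 2 / 2] at [y], off the axis. *)
Definition hess_K2 y v w : R := conformal_factor y *
  ((b v + g * diff_fq y v) * b w + horizontal_dot v w - g * diff_chi y v * conormal y w).

Lemma metric_tensorE y i j : q y != 0 ->
  metric_tensor F x y i j = hess_K2 y (delta_mx 0 i) (delta_mx 0 j).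
Proof.
move=> q0; rewrite mxE; set v := delta_mx 0 i; set w := delta_mx 0 j.
have E1 : \near y, 2 * (conformal_factor y * conormal y w) =
    partial j (fun z => finsler_K F x z ^+ 2 : R^o) y.
  apply: near_imp (near_fq q0) => z qz.
  by have [_ <-] := is_diff_derive w (is_diff_K2 qz).
have d : is_diff y (fun z => 2 * (conformal_factor z * conormal z w)) (fun v => 2 * hess_K2 y v w).
  have dFd : is_diff y (conormal^~ w) (fun v => (b v + g * diff_fq y v) * b w + horizontal_dot v w).
    have bd := is_diff_addf (is_diff_b y) (is_diff_scalef g (is_diff_q q0)).
    have := is_diff_addf (is_diff_scalef (b w) bd) (is_diff_horizontal_dotl w y).
    under eq_fun do rewrite mulrC.
    by move=> /is_diff_eq; apply; apply/funext => u; rewrite [b w * _]mulrC.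
  apply: is_diff_eq (is_diff_scalef 2 (is_diff_mulf (is_diff_conformal_factor q0) dFd)) _.
  apply/funext => u; rewrite /hess_K2.
  by move: (diff_chi y u) (conormal y w) (conformal_factor y) (_ + horizontal_dot _ _) => *; ring.
rewrite /partial -(near_eq_derive _ E1).
by have [_ ->] := is_diff_derive v d; rewrite mulKf// pnatr_eq0.
Qed.

End Metric.

(** * The map onto the unit sphere *)

Lemma sum_ord3 (R : nmodType) (f : 'I_3 -> R) :
  \sum_k f k = f 0 + f 1 + f ord_max.
Proof.
rewrite !big_ord_recr big_ord0/= add0r.
by congr (f _ + f _ + f _); apply/val_inj.
Qed.

Definition triple (R : realType) (a b c : R) (k : 'I_3) : R := [:: a; b; c]`_k.

Lemma sum_triple (R : realType) (a b c a' b' c' : R) :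
  \sum_k triple a b c k * triple a' b' c' k = a * a' + b * b' + c * c'.
Proof. exact: sum_ord3. Qed.

(** The scalar product of the derivatives of two normalized vectors: radial
    parts, measured by the derivatives [dX] and [dY] of the squared norm, drop
    out. *)
Lemma quotient_dot (R : realType) (p0 p1 p2 X0 X1 X2 Y0 Y1 Y2 s dX dY : R) :
  s != 0 -> s ^+ 2 = p0 ^+ 2 + p1 ^+ 2 + p2 ^+ 2 ->
  dX = 2 * (p0 * X0 + p1 * X1 + p2 * X2) ->
  dY = 2 * (p0 * Y0 + p1 * Y1 + p2 * Y2) ->
  let d p X dX := (X - p * dX / (2 * s ^+ 2)) / s in
  d p0 X0 dX * d p0 Y0 dY + d p1 X1 dX * d p1 Y1 dY + d p2 X2 dX * d p2 Y2 dY =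
  (X0 * Y0 + X1 * Y1 + X2 * Y2 - dX * dY / (4 * s ^+ 2)) / s ^+ 2.
Proof.
move=> s0 sE dXE dYE d; rewrite /d.
transitivity ((X0 * Y0 + X1 * Y1 + X2 * Y2
   - dY / (2 * s ^+ 2) * (p0 * X0 + p1 * X1 + p2 * X2)
   - dX / (2 * s ^+ 2) * (p0 * Y0 + p1 * Y1 + p2 * Y2)
   + dX * dY / (4 * s ^+ 4) * (p0 ^+ 2 + p1 ^+ 2 + p2 ^+ 2)) / s ^+ 2).
  by field.
have -> : p0 * X0 + p1 * X1 + p2 * X2 = dX / 2 by rewrite dXE; field.
have -> : p0 * Y0 + p1 * Y1 + p2 * Y2 = dY / 2 by rewrite dYE; field.
by rewrite -sE; field.
Qed.

Section SphereMap.
Variables (R : realType) (F : finsleroid_space R) (x : 'rV[R]_3).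
Hypothesis hx : dom F x.
Variable (E : 'M[R]_3).
Hypothesis hE : adapted_frame F x E.
Implicit Types y v w : 'rV[R]_3.

Local Notation g := (fg F x).
Local Notation h := (fh F x).
Local Notation q := (fq F x).
Local Notation b := (b_form F x).
Local Notation A := (fA F x).
Local Notation B := (fB F x).
Local Notation fr k y := (frame_comp E y 0 k).
Local Notation dot12 := (horizontal_dot E).
Local Notation dq := (diff_fq F x E).
Local Notation dA := (diff_fA F x E).
Local Notation dB := (diff_fB F x E).
Local Notation dF := (conormal F x E).

(** The components of the unit vector with colatitude [h chi] and longitude the
    polar angle. *)
Definition sphere_map (k : 'I_3) y : R :=
  triple (h * fr 0 y / Num.sqrt (B y)) (h * fr 1 y / Num.sqrt (B y))
         (A y / Num.sqrt (B y)) k.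

(** The derivative of [p / sqrt B] when [dp] is that of [p]. *)
Definition dquot (p dp : R) y v : R :=
  (dp - p * dB y v / (2 * B y)) / Num.sqrt (B y).

Definition dsphere (k : 'I_3) y v : R :=
  triple (dquot (h * fr 0 y) (h * fr 0 v) y v)
         (dquot (h * fr 1 y) (h * fr 1 v) y v) (dquot (A y) (dA y v) y v) k.

Lemma is_diff_quot (p : 'rV[R]_3 -> R) dp y : q y != 0 -> is_diff y p dp ->
  is_diff y (fun z => p z / Num.sqrt (B z)) (fun v => dquot (p y) (dp v) y v).
Proof.
move=> q0 pd; have B0 := fB_gt0 hx q0.
have s0 : 0 < Num.sqrt (B y) by rewrite sqrtr_gt0.
have s2 : Num.sqrt (B y) ^+ 2 = B y by rewrite sqr_sqrtr// ltW.
have sd := is_diff_R1 (f := B) (is_derive1_sqrt B0) (is_diff_B hx hE q0).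
have invd := is_diff_R1 (f := fun z => Num.sqrt (B z))
  (is_derive_invR (lt0r_neq0 s0)) sd.
apply: is_diff_eq (is_diff_mulf pd invd) _; apply/funext => v; rewrite /dquot.
move: (Num.sqrt (B y)) s0 s2 => s s0 <-; move: (p y) (dp v) (dB y v) => *.
by field; rewrite gt_eqF.
Qed.

Lemma is_diff_sphere k y : q y != 0 -> is_diff y (sphere_map k) (dsphere k y).
Proof.
move=> q0; case: k => [[|[|[|//]]] i]; apply: is_diff_quot => //;
  try (apply: is_diff_scalef; exact: is_diff_frame).
exact: (is_diff_A hx hE).
Qed.

Lemma twice_diff_sphere k y : q y != 0 -> twice_diff (sphere_map k) y.
Proof.
move=> q0.
have td_sqrt (f : 'rV[R]_3 -> R) : twice_diff f y -> 0 < f y ->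
    twice_diff (fun z => Num.sqrt (f z)) y.
  move=> fd f0.
  apply: (@twice_diff_R1 _ _ _ (fun t : R => (2 * Num.sqrt t)^-1)
    (- (2 * Num.sqrt (f y)) ^- 2 * (2 * (2 * Num.sqrt (f y))^-1))) => //.
    have := open_nbhs_nbhs (conj (open_gt (y := 0)) f0).
    by apply: near_imp => t t0; exact: is_derive1_sqrt.
  have s0 : 2 * Num.sqrt (f y) != 0.
    by rewrite gt_eqF// mulr_gt0// sqrtr_gt0.
  have d2 : is_derive (f y) 1 (fun t : R => 2 * Num.sqrt t)
      (2 * (2 * Num.sqrt (f y))^-1).
    by apply: is_deriveZ; exact: is_derive1_sqrt.
  exact: (is_derive1_comp (f := @GRing.inv R) (g := fun t : R => 2 * Num.sqrt t)
    (is_derive_invR s0) d2).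
have td_inv (f : 'rV[R]_3 -> R) : twice_diff f y -> f y != 0 ->
    twice_diff (fun z => (f z)^-1) y.
  move=> fd f0.
  apply: (@twice_diff_R1 _ _ _ (fun t : R => - t ^- 2)
    (- (- (f y ^+ 2) ^- 2 * (2 * f y)))) => //.
    have := open_nbhs_nbhs (conj (open_neq (y := 0)) f0).
    by apply: near_imp => t t0; exact: is_derive_invR.
  apply: is_deriveN.
  have s0 : f y ^+ 2 != 0 by rewrite expf_neq0.
  have d2 : is_derive (f y) 1 (fun t : R => t ^+ 2) (2 * f y).
    apply: DeriveDef; first exact: exprn_derivable.
    by rewrite exp_derive expr1 [_ *: 1]mulr1.
  exact: (is_derive1_comp (f := @GRing.inv R) (g := fun t : R => t ^+ 2)
    (is_derive_invR s0) d2).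
have td_frame j : twice_diff (fun z => fr j z) y.
  rewrite (_ : (fun z => _) = fun z : 'rV_3 => \sum_i z 0 i * invmx E i j).
    apply: twice_diff_sum => i; apply: twice_diffM.
      exact: twice_diff_coord.
    exact: twice_diff_cst.
  by apply/funext => z; rewrite mxE.
have td_b : twice_diff b y.
  rewrite (_ : b = fun z => fr ord_max z); first exact: td_frame.
  by apply/funext => z; exact: (b_form_frame hx hE).
have td_q : twice_diff q y.
  rewrite (_ : q = fun z => Num.sqrt (dot12 z z)); last first.
    by apply/funext => z; rewrite (horizontal_dot_diag hx hE) sqrtr_sqr ger0_norm ?fq_ge0.
  apply: td_sqrt; last by rewrite (horizontal_dot_diag hx hE) exprn_even_gt0.
  by apply: twice_diffD; apply: twice_diffM.
have td_A : twice_diff A y by apply: twice_diffD => //; apply: twice_diffZ.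
have td_B : twice_diff B y.
  apply: twice_diffD; last exact: twice_diffM.
  apply: twice_diffD; first exact: twice_diffM.
  by apply: twice_diffM => //; apply: twice_diffZ.
have td_s : twice_diff (fun z => (Num.sqrt (B z))^-1) y.
  apply: td_inv; first by apply: td_sqrt => //; exact: (fB_gt0 hx).
  by rewrite gt_eqF// sqrtr_gt0 (fB_gt0 hx).
by case: k => [[|[|[|//]]] i]; apply: twice_diffM => //; apply: twice_diffZ.
Qed.

Lemma sphere_map_norm y : q y != 0 ->
  \sum_k sphere_map k y * sphere_map k y = 1.
Proof.
move=> q0; have B0 := fB_gt0 hx q0.
have s2 : Num.sqrt (B y) ^+ 2 = B y by rewrite sqr_sqrtr// ltW.
have s0 : 0 < Num.sqrt (B y) by rewrite sqrtr_gt0.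
rewrite sum_triple; have := fBE hx y; rewrite -(horizontal_dot_diag hx hE) /horizontal_dot.
move: (Num.sqrt (B y)) s0 s2 => s s0 <-.
move: (fr 0 y) (fr 1 y) (A y) => r0 r1 a sE.
transitivity ((a ^+ 2 + h ^+ 2 * (r0 * r0 + r1 * r1)) / s ^+ 2).
  by field; rewrite gt_eqF.
by rewrite -sE divff// expf_neq0// gt_eqF.
Qed.

(** [B] is the squared norm of [(h R1, h R2, A)]. *)
Lemma dB_half y v : q y != 0 ->
  dB y v = 2 * (h ^+ 2 * dot12 y v + A y * dA y v).
Proof.
move=> q0; have : q y * dq y v = dot12 y v by rewrite /diff_fq mulrC divfK.
rewrite (fh2 hx) /diff_fB /diff_fA /fA => <-.
by move: (b y) (b v) (q y) (dq y v) => *; field.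
Qed.

Lemma dsphere_dot y v w : q y != 0 ->
  \sum_k dsphere k y v * dsphere k y w =
  (h ^+ 2 * dot12 v w + dA y v * dA y w - dB y v * dB y w / (4 * B y)) / B y.
Proof.
move=> q0; have B0 := fB_gt0 hx q0.
have s0 : 0 < Num.sqrt (B y) by rewrite sqrtr_gt0.
have s2 : Num.sqrt (B y) ^+ 2 = B y by rewrite sqr_sqrtr// ltW.
have sE := fBE hx y; rewrite -(horizontal_dot_diag hx hE) /horizontal_dot in sE.
have dv := dB_half v q0; have dw := dB_half w q0.
rewrite /horizontal_dot in dv dw.
rewrite sum_triple /dquot /horizontal_dot.
move: (Num.sqrt (B y)) s0 s2 => s s0 s2; rewrite -s2 in sE *.
rewrite (@quotient_dot _ _ _ _ _ _ _ _ _ _ _ _ _ (lt0r_neq0 s0)).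
- by congr ((_ - _) / _); ring.
- by rewrite sE; ring.
- by rewrite dv; ring.
- by rewrite dw; ring.
Qed.

(** On the indicatrix [T = 1 / B], and for tangent vectors [conormal] eliminates
    [dq]: it equals [- (b + g q) db / q], and then [dB = - g B db / q].  After
    these substitutions both sides are
    [(db db' (1 - g (b + g q) / q) + <v, w>_12) / B]. *)
Lemma sphere_isometry y v w : q y != 0 -> finsler_K F x y = 1 ->
  dF y v = 0 -> dF y w = 0 ->
  hess_K2 F x E y v w =
  (h ^+ 2)^-1 * \sum_k dsphere k y v * dsphere k y w.
Proof.
move=> q0 K1 v0 w0; have B0 := fB_gt0 hx q0.
have cE : conformal_factor F x y = (B y)^-1.
  have := finsler_K2 hx y; rewrite K1 expr1n => E1.
  by apply: (mulfI (lt0r_neq0 B0)); rewrite -E1 divff// gt_eqF.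
have h0 : h != 0 by rewrite gt_eqF// (fh_gt0 hx).
rewrite /hess_K2 w0 mulr0 subr0 dsphere_dot// cE.
have vE : dot12 y v = - ((b y + g * q y) * b v).
  by apply/eqP; rewrite -addr_eq0 addrC; apply/eqP.
have wE : dot12 y w = - ((b y + g * q y) * b w).
  by apply/eqP; rewrite -addr_eq0 addrC; apply/eqP.
have BdB u : dot12 y u = - ((b y + g * q y) * b u) ->
    dB y u = - (g * b u * B y / q y).
  move=> uE; rewrite /diff_fB /diff_fq uE /fB.
  by move: (b y) (b u) (q y) q0 => *; field.
rewrite (BdB v vE) (BdB w wE) /diff_fA /diff_fq vE wE.
rewrite [LHS]mulrC [RHS]mulrA; congr (_ / _).
have h2 := fh2 hx.
have h2E : (b v + 2^-1 * g * (- ((b y + g * q y) * b v) / q y)) *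
   (b w + 2^-1 * g * (- ((b y + g * q y) * b w) / q y)) -
   - (g * b v * B y / q y) * - (g * b w * B y / q y) / (4 * B y) =
   h ^+ 2 * (b v * b w * (1 - g * (b y + g * q y) / q y)).
  rewrite h2 /fB; rewrite /fB in B0.
  move: (b y) (b v) (b w) (q y) q0 B0 => ? ? ? ? q0 B0; field.
  by rewrite q0 gt_eqF.
rewrite -addrA h2E -mulrDr mulKf ?expf_neq0//.
by move: (dot12 v w) (b y) (b v) (b w) (q y) q0 => *; field.
Qed.

(** The derivative of a normalized vector only vanishes in the radial
    direction, so [v] is some [l y], and [conormal y (l y) = l (B y)] forces
    [l = 0]. *)
Lemma dsphere_inj y v : q y != 0 -> dF y v = 0 ->
  (forall k, dsphere k y v = 0) -> v = 0.
Proof.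
move=> q0 Fv sv; have B0 := fB_gt0 hx q0.
have s0 : 0 < Num.sqrt (B y) by rewrite sqrtr_gt0.
have h0 : h != 0 by rewrite gt_eqF// (fh_gt0 hx).
pose l := dB y v / (2 * B y).
have quot0 p dp : dquot p dp y v = 0 -> dp = l * p.
  move=> /eqP; rewrite mulf_eq0 invr_eq0 (gt_eqF s0) orbF subr_eq0 => /eqP ->.
  by rewrite /l mulrC mulrA mulrC mulrA.
have f0 : fr 0 v = l * fr 0 y.
  by apply: (mulfI h0); rewrite (quot0 _ _ (sv 0)); ring.
have f1 : fr 1 v = l * fr 1 y.
  by apply: (mulfI h0); rewrite (quot0 _ _ (sv 1)); ring.
have f2 : dA y v = l * A y by exact: quot0 (sv ord_max).
have d12 : dot12 y v = l * q y ^+ 2.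
  by rewrite -(horizontal_dot_diag hx hE) /horizontal_dot f0 f1; ring.
have bv : b v = l * b y.
  move: f2; rewrite /diff_fA /diff_fq d12 /fA => f2.
  apply: (addIr (2^-1 * g * (l * q y ^+ 2 / q y))); rewrite f2.
  by move: (b y) (q y) q0 => *; field.
have l0 : l = 0.
  apply/eqP; have : l * B y = 0.
    by rewrite -Fv /conormal d12 bv /fB; ring.
  by move/eqP; rewrite mulf_eq0 (gt_eqF B0) orbF.
rewrite -[v](frame_compK hE) (_ : frame_comp E v = 0) ?mul0mx//.
apply/matrixP => i k; rewrite (ord1 i) [RHS]mxE.
rewrite (b_form_frame hx hE) l0 mul0r in bv; rewrite l0 !mul0r in f0 f1.
case: k => [[|[|[|//]]] ik].
- by rewrite -[RHS]f0; congr (fr _ v); apply/val_inj.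
- by rewrite -[RHS]f1; congr (fr _ v); apply/val_inj.
- by rewrite -[RHS]bv; congr (fr _ v); apply/val_inj.
Qed.

End SphereMap.

(** * Charts of the indicatrix *)

Lemma sum_delta_linear (R : pzRingType) n (H : 'rV[R]_n -> R) :
  (forall a (v w : 'rV[R]_n), H (a *: v + w) = a * H v + H w) ->
  forall v : 'rV[R]_n, \sum_i v 0 i * H (delta_mx 0 i) = H v.
Proof.
move=> lin v.
have H0 : H 0 = 0.
  have := lin 1 0 0; rewrite scaler0 addr0 mul1r => /eqP.
  by rewrite -subr_eq0 opprD addrA subrr sub0r oppr_eq0 => /eqP.
have HD a b : H (a + b) = H a + H b by rewrite -[a]scale1r lin scale1r mul1r.
rewrite [in RHS](row_sum_delta v) (big_morph H HD H0); apply: eq_bigr => i _.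
by rewrite -[_ *: _]addr0 lin H0 addr0.
Qed.

Section Charts.
Variables (R : realType) (F : finsleroid_space R) (x : 'rV[R]_3).
Hypothesis hx : dom F x.
Variable (E : 'M[R]_3).
Hypothesis hE : adapted_frame F x E.
Implicit Types y v w : 'rV[R]_3.

Local Notation h := (fh F x).
Local Notation q := (fq F x).
Local Notation dF := (conormal F x E).
Local Notation G := (metric_tensor F x).
Local Notation S := (indicatrix F x).
Local Notation fr k y := (frame_comp E y 0 k).

Lemma frame_linear k a v w : fr k (a *: v + w) = a * fr k v + fr k w.
Proof. by rewrite /frame_comp mulmxDl -scalemxAl !mxE. Qed.

Lemma b_form_linear a v w :
  b_form F x (a *: v + w) = a * b_form F x v + b_form F x w.
Proof. by rewrite !(b_form_frame hx hE) frame_linear. Qed.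

Lemma metric_tensor_form y v w : q y != 0 ->
  \sum_i \sum_j G y i j * v 0 i * w 0 j = hess_K2 F x E y v w.
Proof.
move=> q0.
have linr u : forall a v w, hess_K2 F x E y u (a *: v + w) =
    a * hess_K2 F x E y u v + hess_K2 F x E y u w.
  move=> a v' w'; rewrite /hess_K2 /conormal /horizontal_dot !frame_linear b_form_linear.
  by ring.
have linl u : forall a v w, hess_K2 F x E y (a *: v + w) u =
    a * hess_K2 F x E y v u + hess_K2 F x E y w u.
  move=> a v' w'; rewrite /hess_K2 /diff_chi /diff_fq /horizontal_dot !frame_linear b_form_linear.
  by ring.
rewrite -(sum_delta_linear (linl w)); apply: eq_bigr => i _.
rewrite -(sum_delta_linear (linr _)) mulr_sumr; apply: eq_bigr => j _.
by rewrite (metric_tensorE hx hE)//; ring.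
Qed.

(** [K ^ 2] is constant along [Y]. *)
Lemma tangent_conormal (U : normedModType R) (Y : U -> 'rV[R]_3) (u v : U) dY :
  (\near u, S (Y u)) -> q (Y u) != 0 -> is_derive u v Y dY -> dF (Y u) dY = 0.
Proof.
move=> YS q0 Yd; have K1 : finsler_K F x (Y u) = 1 := nbhs_singleton YS.
have K2d := is_diff_K2 hx hE q0.
have d1 := is_derive_chain Yd (ex_diff (is_diff_def := K2d)).
have E1 : \near u, finsler_K F x (Y u) ^+ 2 = 1.
  by apply: near_imp YS => z; rewrite /indicatrix/= => ->; rewrite expr1n.
have [_] := d1; rewrite (near_eq_derive _ E1) derive_cst.
have [_ ->] := is_diff_derive dY K2d => /esym/eqP.
by rewrite !mulf_eq0 pnatr_eq0 /conformal_factor (gt_eqF (expR_gt0 _))/= => /eqP.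
Qed.

(** By the chain rule, [sphere_isometry] passes to the velocities of any map into
    the indicatrix: a chart, or the curve itself. *)
Lemma metric_pullback (U : normedModType R) (Y : U -> 'rV[R]_3) (u v w : U) dv dw :
  (\near u, S (Y u)) -> q (Y u) != 0 ->
  is_derive u v Y dv -> is_derive u w Y dw ->
  \sum_i \sum_j G (Y u) i j * dv 0 i * dw 0 j =
  (h ^+ 2)^-1 * \sum_k 'D_v (fun z => sphere_map F x E k (Y z)) u *
                       'D_w (fun z => sphere_map F x E k (Y z)) u.
Proof.
move=> YS q0 vd wd; rewrite metric_tensor_form//.
rewrite (sphere_isometry hx hE q0 (nbhs_singleton YS)
  (tangent_conormal YS q0 vd) (tangent_conormal YS q0 wd)).
congr (_ * _); apply: eq_bigr => k _.
have sd := is_diff_sphere hx hE k q0.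
have dE dz z : is_derive u z Y dz ->
    'D_z (fun z => sphere_map F x E k (Y z)) u = dsphere F x E k (Y u) dz.
  move=> zd; have [_ ->] := is_derive_chain zd (ex_diff (is_diff_def := sd)).
  by have [_ ->] := is_diff_derive dz sd.
by rewrite (dE _ _ vd) (dE _ _ wd).
Qed.

Section Chart.
Variables (W : set 'rV[R]_2) (Y : 'rV[R]_2 -> 'rV[R]_3).
Hypothesis YW : local_chart S W Y.
Local Notation n := (fun k u => sphere_map F x E k (Y u)).

Lemma chart_twice_diff u : W u -> twice_diff Y u.
Proof. by move=> Wu; have [Wo Y2 _ _ _] := YW; exact: Ck2_twice_diff Wo Y2 Wu. Qed.

Lemma chart_near u : W u -> q (Y u) != 0 ->
  \near u, W u /\ q (Y u) != 0.
Proof.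
move=> Wu q0; have [Wo _ _ _ _] := YW.
have Yc := twice_diff_continuous (chart_twice_diff Wu).
have W1 := open_nbhs_nbhs (conj Wo Wu).
by apply: near_imp2 W1 (Yc _ (near_fq hx hE q0)).
Qed.

Lemma sphere_chart_twice_diff k u : W u -> q (Y u) != 0 -> twice_diff (n k) u.
Proof.
move=> Wu q0.
apply: (twice_diff_comp (f := sphere_map F x E k) (chart_twice_diff Wu)).
exact: (twice_diff_sphere hx hE k q0).
Qed.

Lemma chart_partial a u : W u -> is_derive u (delta_mx 0 a) Y (partial a Y u).
Proof.
move=> /chart_twice_diff[/nbhs_singleton Yd _].
by apply: derivableP; exact: diff_derivable.
Qed.

Lemma chart_image u : W u -> \near u, S (Y u).
Proof.
have [Wo _ YS _ _] := YW.
by move=> Wu; apply: near_imp (open_nbhs_nbhs (conj Wo Wu)).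
Qed.

Lemma induced_metric_gram u : W u -> q (Y u) != 0 ->
  induced_metric G Y u = (h ^+ 2)^-1 *: gram n u.
Proof.
move=> Wu q0; apply/matrixP => a b; rewrite !mxE.
exact: (metric_pullback (chart_image Wu) q0 (chart_partial a Wu)
  (chart_partial b Wu)).
Qed.

(** The image of the chart on the sphere is an immersion: a vector of its kernel
    is tangent to the indicatrix and killed by the differential of the sphere
    map, hence zero. *)
Lemma chart_sphere_free u (al : 'rV[R]_2) : W u -> q (Y u) != 0 ->
  (forall k, \sum_a al 0 a * partial a (n k) u = 0) -> al = 0.
Proof.
move=> Wu q0 al0.
have [Yd _] := chart_twice_diff Wu; have {}Yd := nbhs_singleton Yd.
have Yal : is_derive u al Y ('D_al Y u).
  by apply: derivableP; exact: diff_derivable.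
have V0 : 'D_al Y u = 0.
  apply: (dsphere_inj hx hE q0 (tangent_conormal (chart_image Wu) q0 Yal)) => k.
  have sd := is_diff_sphere hx hE k q0.
  have [_] := is_diff_derive ('D_al Y u) sd => <-.
  have [_ <-] := is_derive_chain Yal (ex_diff (is_diff_def := sd)).
  rewrite derive_delta_sum ?al0//.
  by have [/nbhs_singleton] := sphere_chart_twice_diff k Wu q0.
have [_ _ _ _ free] := YW; have := free u Wu.
rewrite -kermx_eq0 => /rowV0P; apply.
apply/sub_kermxP; rewrite -[RHS]V0 derive_delta_sum//.
apply/matrixP => i j; rewrite (ord1 i) !mxE summxE.
by apply: eq_bigr => a _; rewrite !mxE.
Qed.

(** The metric is a multiple of the Gram matrix of independent vectors. *)
Lemma induced_metric_unit u : W u -> q (Y u) != 0 ->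
  induced_metric G Y u \in unitmx.
Proof.
move=> Wu q0; rewrite -row_free_unit -kermx_eq0; apply/rowV0P => al.
move=> /sub_kermxP alG; apply: (chart_sphere_free Wu q0) => k.
have h0 : h != 0 by rewrite gt_eqF// (fh_gt0 hx).
have : \sum_k (\sum_a al 0 a * partial a (n k) u) ^+ 2 = 0.
  pose J : 'M[R]_(2, 3) := \matrix_(a, k) partial a (n k) u.
  have gramE : gram n u = J *m J^T.
    by apply/matrixP => a b; rewrite !mxE; apply: eq_bigr => k' _; rewrite !mxE.
  have : (al *m J *m (al *m J)^T) 0 0 = 0.
    rewrite trmx_mul mulmxA -(mulmxA al) -gramE.
    have -> : gram n u = h ^+ 2 *: induced_metric G Y u.
      by rewrite induced_metric_gram// scalerA divff ?scale1r// expf_neq0.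
    by rewrite -scalemxAr alG scaler0 mul0mx mxE.
  apply: etrans; rewrite mxE; apply: eq_bigr => k' _; rewrite [X in _ = _ * X]mxE expr2.
  suff -> : (al *m J) 0 k' = \sum_a al 0 a * partial a (n k') u by [].
  by rewrite mxE; apply: eq_bigr => a _; rewrite mxE.
move=> /eqP; rewrite psumr_eq0; last by move=> ? _; exact: sqr_ge0.
by move=> /allP/(_ k (mem_index_enum _)); rewrite sqrf_eq0 => /eqP.
Qed.


End Chart.
End Charts.

(** * Geodesics as oscillations on the sphere *)

(** Differentiate [<n, n> = 1]. *)
Lemma unit_vector_orth (R : realType) p (U : normedModType R)
    (n : 'I_p -> U -> R) u v :
  (\near u, \sum_k n k u * n k u = 1) -> (forall k, derivable (n k) u v) ->
  \sum_k n k u * 'D_v (n k) u = 0.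
Proof.
move=> n1 nd.
have d : is_derive u v (fun z => \sum_k n k z * n k z)
    (\sum_k (n k u * 'D_v (n k) u + n k u * 'D_v (n k) u)).
  by apply: is_derive_sumf => k; apply: is_derive_mulf; exact: derivableP.
have [_] := d; rewrite (near_eq_derive _ n1) derive_cst => /esym.
rewrite big_split/= => /eqP; rewrite -mulr2n mulrn_eq0/= => /eqP; exact.
Qed.

Section Ode.
Variables (R : realType) (F : finsleroid_space R) (x : 'rV[R]_3).
Hypothesis hx : dom F x.
Variable (E : 'M[R]_3).
Hypothesis hE : adapted_frame F x E.

Local Notation h := (fh F x).
Local Notation q := (fq F x).
Local Notation G := (metric_tensor F x).
Local Notation S := (indicatrix F x).

Variables (I : set R) (c : R -> 'rV[R]_3).
Hypothesis I_open : open I.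
Hypothesis hc : forall s, I s -> S (c s).
Hypothesis hq : forall s, I s -> q (c s) != 0.
Local Notation m := (fun k s => sphere_map F x E k (c s)).

Lemma sphere_speed s : I s -> derivable c s 1 ->
  \sum_(i < 3) \sum_(j < 3) G (c s) i j * derive1 c s 0 i * derive1 c s 0 j =
  (h ^+ 2)^-1 * \sum_k derive1 (m k) s ^+ 2.
Proof.
move=> Is cd.
have cS : \near s, S (c s).
  by apply: near_imp (open_nbhs_nbhs (conj I_open Is)) => t; exact: hc.
rewrite (metric_pullback hx hE cS (hq Is) (is_derive1P cd) (is_derive1P cd)).
by apply: congr1; apply: eq_bigr => k _; rewrite -expr2 derive1E.
Qed.

Lemma sphere_norm s : I s -> \sum_k m k s * m k s = 1.
Proof. by move=> Is; rewrite (sphere_map_norm hx hE (hq Is)). Qed.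

Section InChart.
Variables (W : set 'rV[R]_2) (Y : 'rV[R]_2 -> 'rV[R]_3).
Hypothesis YW : local_chart S W Y.
Variables (u : R -> 'rV[R]_2) (s : R).
Hypothesis Is : I s.
Hypothesis cu : \near s, W (u s) /\ c s = Y (u s).
Hypothesis u_derivable : \near s, derivable u s 1.
Hypothesis u_derivable2 : derivable (derive1 u) s 1.
Local Notation n := (fun k u => sphere_map F x E k (Y u)).

Let Wus : W (u s). Proof. by have [] := nbhs_singleton cu. Qed.
Let cs : c s = Y (u s). Proof. by have [] := nbhs_singleton cu. Qed.
Let qus : q (Y (u s)) != 0. Proof. by rewrite -cs; exact: hq. Qed.

Let gammaE : \forall v \near u s,
  induced_metric G Y v = (h ^+ 2)^-1 *: gram n v.
Proof.
apply: near_imp (chart_near hx hE YW Wus qus) => v [Wv qv].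
exact: (induced_metric_gram hx hE YW Wv qv).
Qed.

Lemma sphere_accel_near k :
  \near s, derive1 (m k) s = derive1 (fun t => n k (u t)) s.
Proof.
have /near_join E1 : \near s, m k s = n k (u s).
  by apply: near_imp cu => t [_ ->].
by apply: near_imp E1 => t; exact: near_derive1.
Qed.

Lemma chart_normal d : \sum_k partial d (n k) (u s) * m k s = 0.
Proof.
have n1 : \forall v \near u s, \sum_k n k v * n k v = 1.
  apply: near_imp (chart_near hx hE YW Wus qus) => v [Wv qv].
  by rewrite (sphere_map_norm hx hE qv).
rewrite -[RHS](unit_vector_orth (v := delta_mx 0 d) n1); last first.
  move=> k; apply: diff_derivable.
  by have [/nbhs_singleton] := sphere_chart_twice_diff hx hE YW k Wus qus.
by apply: eq_bigr => k _; rewrite mulrC cs.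
Qed.

Lemma geodesic_equation_sphere :
  geodesic_equation (induced_metric G Y) u s <->
  forall d, \sum_k partial d (n k) (u s) * derive1 (derive1 (m k)) s = 0.
Proof.
have h0 : (h ^+ 2)^-1 != 0 by rewrite invr_eq0 expf_neq0// gt_eqF// (fh_gt0 hx).
apply: (iff_trans (geodesic_equation_normal
  (fun k => sphere_chart_twice_diff hx hE YW k Wus qus) gammaE h0
  (induced_metric_unit hx hE YW Wus qus) u_derivable u_derivable2
  (fun _ _ => erefl) (fun _ _ _ => erefl) erefl erefl)).
have E1 d : normal_accel n u s d =
    \sum_k partial d (n k) (u s) * derive1 (derive1 (m k)) s.
  apply: eq_bigr => k _.
  exact: (congr1 ( *%R _) (esym (near_derive1 (sphere_accel_near k)))).
by split=> eq0 d; [rewrite -E1|rewrite E1].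
Qed.

Lemma geodesic_of_accel :
  (forall k, derive1 (derive1 (m k)) s = - (h ^+ 2 * m k s)) ->
  geodesic_equation (induced_metric G Y) u s.
Proof.
move=> acc; apply/geodesic_equation_sphere => d.
under eq_bigr do rewrite acc mulrN mulrCA.
by rewrite sumrN -mulr_sumr chart_normal mulr0 oppr0.
Qed.

Lemma sphere_derivable k : derivable (m k) s 1.
Proof.
have ud := nbhs_singleton u_derivable.
have [/nbhs_singleton nd _] := sphere_chart_twice_diff hx hE YW k Wus qus.
have [d _] := is_derive1_along ud nd.
apply: near_eq_derivable d.
by apply: near_imp cu => t [_ ->].
Qed.

Lemma sphere_derivable2 k : derivable (derive1 (m k)) s 1.
Proof.
have [d _] := is_derive2_along
  (fun k => sphere_chart_twice_diff hx hE YW k Wus qus) u_derivable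
  u_derivable2 (fun _ _ => erefl) (fun _ _ _ => erefl) erefl erefl k.
apply: near_eq_derivable d.
exact: (near_imp (fun t => @esym _ _ _) (sphere_accel_near k)).
Qed.

(** The position vector and the two coordinate vectors of the sphere form a basis
    of the ambient space. *)
Lemma normal_eq0 (w : 'I_3 -> R) :
  (forall d, \sum_k partial d (n k) (u s) * w k = 0) ->
  \sum_k m k s * w k = 0 -> forall k, w k = 0.
Proof.
move=> wn wm.
pose r : 'rV[R]_3 := \row_k m k s.
pose J : 'M[R]_(2, 3) := \matrix_(a, k) partial a (n k) (u s).
pose M : 'M[R]_3 := col_mx r J.
pose wc : 'cV[R]_3 := \col_k w k.
have Mu : M \in unitmx.
  rewrite -row_free_unit -kermx_eq0; apply/rowV0P => al /sub_kermxP alM.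
  pose a0 : 'rV[R]_1 := @lsubmx _ 1 1 2 al; pose a1 : 'rV[R]_2 := @rsubmx _ 1 1 2 al.
  have alE : al = row_mx a0 a1 by rewrite hsubmxK.
  clearbody a0 a1.
  have aM k : a0 0 0 * m k s + \sum_a a1 0 a * partial a (n k) (u s) = 0.
    have : a0 *m r + a1 *m J = 0.
      by rewrite -[LHS](mul_row_col a0 a1 r J) -alE; exact: alM.
    move=> /matrixP/(_ 0 k); rewrite [in X in _ = X -> _]mxE => E1.
    apply: etrans E1; rewrite mxE; congr (_ + _).
      by rewrite mxE big_ord1 mxE.
    by rewrite mxE; apply: eq_bigr => a _; rewrite mxE.
  have a00 : a0 0 0 = 0.
    have : \sum_k m k s * (a0 0 0 * m k s + \sum_a a1 0 a * partial a (n k) (u s)) = 0.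
      by apply: big1 => k _; rewrite aM mulr0.
    under eq_bigr do rewrite mulrDr mulrCA mulr_sumr.
    rewrite big_split/= -mulr_sumr (sphere_norm Is) mulr1 exchange_big/=.
    rewrite [X in _ + X]big1 ?addr0// => a _.
    under eq_bigr do rewrite mulrCA [m _ s * _]mulrC.
    by rewrite -mulr_sumr chart_normal mulr0.
  have a10 : a1 = 0.
    apply: (chart_sphere_free hx hE YW Wus qus) => k.
    by have := aM k; rewrite a00 mul0r add0r.
  rewrite alE a10 (_ : a0 = 0) ?row_mx0//.
  by apply/matrixP => i j; rewrite !ord1 mxE.
have Mw : M *m wc = 0.
  have r0 : r *m wc = 0.
    apply/matrixP => i j; rewrite !ord1 [RHS]mxE; apply: etrans wm; rewrite mxE.
    by apply: eq_bigr => k _; rewrite !mxE.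
  have J0 : J *m wc = 0.
    apply/matrixP => a j; rewrite !ord1 [RHS]mxE; apply: etrans (wn a).
    by rewrite mxE; apply: eq_bigr => k _; rewrite !mxE.
  by have := mul_col_mx r J wc; rewrite r0 J0 col_mx0.
move=> k; have : wc k 0 = 0 by rewrite -[wc](mulKmx Mu) Mw mulmx0 mxE.
by rewrite mxE.
Qed.

End InChart.

(** The acceleration [m''] is normal to the sphere, and its component along [m]
    is [- <m', m'> = - h ^ 2] by the choice of the parameter; hence
    [m'' + h ^ 2 m] is orthogonal to a basis. *)
Lemma geodesic_sphere_ode : geodesic S G I c -> arc_length_param G I c ->
  forall s, I s -> [/\ forall k, derivable (m k) s 1,
    forall k, is_derive s 1 (derive1 (m k)) (- (h ^+ 2 * m k s)) &
    \sum_k derive1 (m k) s ^+ 2 = h ^+ 2].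
Proof.
move=> geo arc.
have h0 : h ^+ 2 != 0 by rewrite expf_neq0// gt_eqF// (fh_gt0 hx).
have speed s : I s -> \sum_k derive1 (m k) s ^+ 2 = h ^+ 2.
  move=> Is; have [cd] := arc s Is; rewrite sphere_speed// => E1.
  by rewrite -[LHS](mulVKf h0) E1 mulr1.
have chart s : I s -> exists W Y u, [/\ local_chart S W Y,
    \near s, W (u s) /\ c s = Y (u s), \near s, derivable u s 1,
    derivable (derive1 u) s 1 & geodesic_equation (induced_metric G Y) u s].
  move=> Is; have [W [Y [J [u [YW Jo Js uJ]]]]] := geo s Is.
  have Js' : \near s, J s by exact: open_nbhs_nbhs (conj Jo Js).
  exists W, Y, u; split=> //.
  - by apply: near_imp Js' => t /uJ[].
  - by apply: near_imp Js' => t /uJ[_ _ []].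
  - by have [_ _ []] := uJ s Js.
  - by have [] := uJ s Js.
have md s : I s -> forall k, derivable (m k) s 1.
  move=> Is; have [W [Y [u [YW cu ud ud2 _]]]] := chart s Is.
  exact: (sphere_derivable YW Is cu ud).
move=> s Is; have [W [Y [u [YW cu ud ud2 geos]]]] := chart s Is.
have md2 := sphere_derivable2 YW Is cu ud ud2.
have Is' : \near s, I s by exact: open_nbhs_nbhs (conj I_open Is).
split; [exact: md|move=> k|exact: speed].
have acc0 : \sum_k m k s * (derive1 (derive1 (m k)) s + h ^+ 2 * m k s) = 0.
  have mm0 : \near s, \sum_k m k s * derive1 (m k) s = 0.
    have /near_join n1 : \near s, \sum_k m k s * m k s = 1.
      by apply: near_imp Is' => t; exact: sphere_norm.
    apply: near_imp2 n1 Is' => t n1 It.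
    rewrite -[RHS](unit_vector_orth n1 (md t It)).
    by apply: eq_bigr => j _; rewrite derive1E.
  have d : is_derive s 1 (fun t => \sum_k m k t * derive1 (m k) t)
      (\sum_k (m k s * derive1 (derive1 (m k)) s + derive1 (m k) s * derive1 (m k) s)).
    apply: is_derive_sumf => j.
    exact: (is_derive_mulf (is_derive1P (md s Is j)) (is_derive1P (md2 j))).
  have [_] := d; rewrite (near_eq_derive _ mm0) derive_cst big_split/=.
  under [X in _ + X]eq_bigr do rewrite -expr2.
  rewrite speed// => /esym E1.
  under eq_bigr do rewrite mulrDr mulrCA.
  by rewrite big_split/= -mulr_sumr sphere_norm// mulr1.
have w0 := normal_eq0 YW Is cu (w := fun k => _) _ acc0 k.
have -> : - (h ^+ 2 * m k s) = derive1 (derive1 (m k)) s.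
  apply/eqP; rewrite eq_sym -addr_eq0; apply/eqP; apply: w0 => d.
  under eq_bigr do rewrite mulrDr.
  rewrite big_split/= (geodesic_equation_sphere YW Is cu ud ud2).1// add0r.
  under eq_bigr do rewrite mulrCA.
  by rewrite -mulr_sumr (chart_normal YW Is cu) mulr0.
exact: is_derive1P.
Qed.

End Ode.

(** * Functions on an interval and great circles *)

Section RealInterval.
Variables (R : realType) (I : set R).
Hypothesis I_open : open I.
Hypothesis I_itv : is_interval I.

Lemma within_open_continuous (f : R -> R) :
  {within I, continuous f} <-> forall s, I s -> {for s, continuous f}.
Proof.
rewrite continuous_open_subspace//; split=> fc s.
  by move=> Is; apply: fc; rewrite inE.
by rewrite inE => Is; exact: fc.
Qed.

Lemma itv_sub a b t : I a -> I b -> a <= t <= b -> I t.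
Proof. by move=> Ia Ib; exact: I_itv. Qed.

Lemma interval_value (f : R -> R) a b v :
  (forall s, I s -> {for s, continuous f}) -> I a -> I b ->
  Num.min (f a) (f b) <= v <= Num.max (f a) (f b) ->
  exists2 t, I t & f t = v.
Proof.
move=> fc.
have main c d : c <= d -> I c -> I d ->
    Num.min (f c) (f d) <= v <= Num.max (f c) (f d) ->
    exists2 t, I t & f t = v.
  move=> cd Ic Id fv.
  have fw : {within `[c, d], continuous f}.
    apply: continuous_in_subspaceT => t; rewrite inE/= in_itv/= => tcd.
    by apply: fc; exact: itv_sub tcd.
  have [t] := IVT cd fw fv; rewrite in_itv/= => tcd ft; exists t => //.
  exact: itv_sub tcd.
move=> Ia Ib; have [ab|/ltW ba] := leP a b; first exact: main.
by rewrite minC maxC; exact: main.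
Qed.

Lemma interval_sign (f : R -> R) :
  (forall s, I s -> {for s, continuous f}) -> (forall s, I s -> f s != 0) ->
  exists2 e : R, e ^+ 2 = 1 & forall s, I s -> 0 < e * f s.
Proof.
move=> fc f0.
have [[s0 Is0]|noI] := pselect (exists s, I s); last first.
  by exists 1; [rewrite expr1n|move=> s Is; case: noI; exists s].
have key s : I s -> 0 < f s0 * f s.
  move=> Is; rewrite ltNge; apply/negP => neg.
  have [|t It /eqP] := interval_value (v := 0) fc Is0 Is; last first.
    by rewrite (negPf (f0 t It)).
  rewrite ge_min le_max.
  have := f0 _ Is0; have := f0 _ Is; rewrite !neq_lt.
  move=> /orP[n1|p1] /orP[n0|p0].
  - by move: neg; rewrite leNgt nmulr_rgt0// n1.
  - by rewrite (ltW n1) (ltW p0) orbT.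
  - by rewrite (ltW n0) (ltW p1) orbT.
  - by move: neg; rewrite leNgt mulr_gt0.
exists (Num.sg (f s0)); first by rewrite sqr_sg f0.
move=> s Is; have := key s Is.
have := f0 _ Is0; rewrite neq_lt => /orP[n0|p0].
  by rewrite ltr0_sg// mulN1r oppr_gt0 nmulr_rgt0.
by rewrite gtr0_sg// mul1r pmulr_rgt0.
Qed.

Lemma const_of_derive0 (f : R -> R) :
  (forall s, I s -> is_derive s 1 f 0) ->
  forall a b, I a -> I b -> f a = f b.
Proof.
move=> fd.
suff main a b : a <= b -> I a -> I b -> f b = f a.
  by move=> a b Ia Ib; have [/main->//|/ltW/main->//] := leP a b.
move=> ab Ia Ib; apply/eqP; rewrite -subr_eq0.
have fd' (t : R) : a <= t <= b -> is_derive t 1 f 0.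
  by move=> tab; apply: fd; exact: itv_sub tab.
have [||t _ ->] := @MVT_segment R f (fun=> 0) a b ab.
- by move=> t; rewrite in_itv/= => /andP[/ltW ? /ltW ?]; apply/fd'/andP.
- apply: derivable_within_continuous => t; rewrite in_itv/= => tab.
  by have [] := fd' t tab.
by rewrite mul0r.
Qed.

Lemma is_derive_affine (h s0 s : R) :
  is_derive s 1 (fun t : R => h * (t - s0)) h.
Proof.
have d1 : is_derive s 1 (fun t : R => t - s0) 1.
  by apply: is_derive_eq (is_deriveB (is_derive_id s 1) (is_derive_cst s0 s 1)) _;
    rewrite subr0.
by apply: is_derive_eq (is_deriveZ h d1) _; rewrite [LHS]mulr1.
Qed.

Lemma is_derive_cos_affine (h s0 s : R) :
  is_derive s 1 (fun t => cos (h * (t - s0))) (- (h * sin (h * (s - s0)))).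
Proof.
have d := is_derive_affine h s0 s.
apply: is_derive_eq (is_deriveR1 (f := fun t : R => h * (t - s0)) (is_derive_cos _) d) _.
by rewrite mulNr mulrC.
Qed.

Lemma is_derive_sin_affine (h s0 s : R) :
  is_derive s 1 (fun t => sin (h * (t - s0))) (h * cos (h * (s - s0))).
Proof.
have d := is_derive_affine h s0 s.
apply: is_derive_eq (is_deriveR1 (f := fun t : R => h * (t - s0)) (is_derive_sin _) d) _.
by rewrite mulrC.
Qed.

(** Rotating the phase vector [(m, m' / h)] back by the angle [h (s - s1)] gives
    constants. *)
Lemma harmonic_solution (h : R) (m : R -> R) s1 : h != 0 -> I s1 ->
  (forall s, I s -> derivable m s 1) ->
  (forall s, I s -> is_derive s 1 (derive1 m) (- (h ^+ 2 * m s))) ->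
  forall s, I s -> m s = m s1 * cos (h * (s - s1)) +
                         derive1 m s1 / h * sin (h * (s - s1)).
Proof.
move=> h0 Is1 md md2 s Is.
pose C t := cos (h * (t - s1)); pose D t := sin (h * (t - s1)).
have CD t : C t ^+ 2 + D t ^+ 2 = 1 by exact: cos2Dsin2.
have dC (t : R) : is_derive t 1 C (- (h * D t)) by exact: is_derive_cos_affine.
have dD (t : R) : is_derive t 1 D (h * C t) by exact: is_derive_sin_affine.
pose P t := m t * C t - h^-1 * (derive1 m t * D t).
pose Q t := m t * D t + h^-1 * (derive1 m t * C t).
have dP (t : R) : I t -> is_derive t 1 P 0.
  move=> It; have m1 := is_derive1P (md t It); have m2 := md2 t It.
  apply: is_derive_eq (is_deriveB (is_derive_mulf m1 (dC t))
    (is_deriveZ h^-1 (is_derive_mulf m2 (dD t)))) _.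
  rewrite -[_ *: _]/(_ * _).
  by move: (derive1 m t) (m t) (C t) (D t) => *; field.
have dQ (t : R) : I t -> is_derive t 1 Q 0.
  move=> It; have m1 := is_derive1P (md t It); have m2 := md2 t It.
  apply: is_derive_eq (is_deriveD (is_derive_mulf m1 (dD t))
    (is_deriveZ h^-1 (is_derive_mulf m2 (dC t)))) _.
  rewrite -[_ *: _]/(_ * _).
  by move: (derive1 m t) (m t) (C t) (D t) => *; field.
have P1 : P s = m s1.
  rewrite (const_of_derive0 dP Is Is1) /P /C /D subrr mulr0 cos0 sin0.
  by rewrite !mulr0 mulr1 subr0.
have Q1 : Q s = derive1 m s1 / h.
  rewrite (const_of_derive0 dQ Is Is1) /Q /C /D subrr mulr0 cos0 sin0.
  by rewrite mulr0 mulr1 add0r mulrC.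
rewrite -P1 -Q1 -/(C s) -/(D s) -[LHS]mulr1 -(CD s) /P /Q.
by move: (derive1 m s) (m s) (C s) (D s) => *; field.
Qed.

End RealInterval.

Section Circle.
Variable R : realType.

(** The angle is [acos (a / r)] up to the sign of [b]. *)
Lemma polar_exists (a b : R) : exists t,
  a = Num.sqrt (a ^+ 2 + b ^+ 2) * cos t /\ b = Num.sqrt (a ^+ 2 + b ^+ 2) * sin t.
Proof.
set r := Num.sqrt _.
have r2 : r ^+ 2 = a ^+ 2 + b ^+ 2 by rewrite sqr_sqrtr// addr_ge0// sqr_ge0.
have r_ge0 : 0 <= r by exact: sqrtr_ge0.
have [r0|r0] := eqVneq r 0.
  move: r2; rewrite r0 expr0n/= => /esym/eqP.
  rewrite paddr_eq0 ?sqr_ge0// !sqrf_eq0 => /andP[/eqP-> /eqP->].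
  by exists 0; rewrite !mul0r.
have rp : 0 < r by rewrite lt_def r0.
have ar : -1 <= a / r <= 1.
  have : (a / r) ^+ 2 <= 1.
    by rewrite expr_div_n ler_pdivrMr ?exprn_gt0// mul1r r2 lerDl sqr_ge0.
  move: (a / r) => u u2; apply/andP; split; rewrite leNgt; apply/negP => ?; nra.
have ca : cos (acos (a / r)) = a / r by rewrite acosK.
have sa : sin (acos (a / r)) = `|b| / r.
  rewrite sin_acos//; apply/eqP.
  rewrite -(eqrXn2 (n := 2)) ?sqrtr_ge0 ?divr_ge0 ?normr_ge0//.
  rewrite sqr_sqrtr; last first.
    by move: (a / r) ar => u /andP[u1 u2]; nra.
  rewrite !expr_div_n real_normK ?num_real// (_ : b ^+ 2 = r ^+ 2 - a ^+ 2).
    by rewrite mulrBl divff// sqrf_eq0.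
  by rewrite r2 addrC addKr.
have [b0|b0] := leP 0 b.
  exists (acos (a / r)); rewrite ca sa ger0_norm//.
  by rewrite ![r * _]mulrC !divfK.
exists (- acos (a / r)); rewrite cosN sinN ca sa ltr0_norm//.
by rewrite mulNr opprK ![r * _]mulrC !divfK.
Qed.

(** The shift [de] is chosen so that at [t = de] the height is greatest.  The
    velocity is then horizontal, which defines [al], and [ka] is the third
    component of the cross product of [v] and [w], invariant under the shift. *)
Lemma great_circle_normal_form (v w : 'I_3 -> R) :
  \sum_k v k * v k = 1 -> \sum_k w k * w k = 1 -> \sum_k v k * w k = 0 ->
  exists ka de al : R, ka ^+ 2 <= 1 /\ forall t,
  [/\ v 0 * cos t + w 0 * sin t =
        ka * cos al * cos (t - de) - sin al * sin (t - de),
      v 1 * cos t + w 1 * sin t =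
        ka * sin al * cos (t - de) + cos al * sin (t - de) &
      v ord_max * cos t + w ord_max * sin t =
        Num.sqrt (1 - ka ^+ 2) * cos (t - de)].
Proof.
rewrite !sum_ord3.
move: (v 0) (v 1) (v ord_max) (w 0) (w 1) (w ord_max) => v0 v1 v2 w0 w1 w2 vv ww vw.
pose ka := v0 * w1 - v1 * w0.
have kaE : 1 - ka ^+ 2 = v2 ^+ 2 + w2 ^+ 2.
  have v2E : v2 * v2 = 1 - v0 * v0 - v1 * v1 by rewrite -vv; ring.
  have w2E : w2 * w2 = 1 - w0 * w0 - w1 * w1 by rewrite -ww; ring.
  have vwE : v2 * w2 = - (v0 * w0 + v1 * w1) by rewrite -[LHS](addKr (v0 * w0 + v1 * w1)) vw addr0.
  have E1 : (v2 * w2) ^+ 2 = (v2 * v2) * (w2 * w2) by ring.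
  move: E1; rewrite vwE v2E w2E !expr2 v2E w2E /ka => E1; nra.
have [de [v2E w2E]] := polar_exists v2 w2.
rewrite -kaE in v2E w2E; set rho := Num.sqrt _ in v2E w2E *.
have cs := cos2Dsin2 de.
(* [x0, x1] is the horizontal part of the highest point of the circle, at
   [t = de]; [y0, y1] is that of the velocity there *)
pose x0 := v0 * cos de + w0 * sin de; pose x1 := v1 * cos de + w1 * sin de.
pose y0 := w0 * cos de - v0 * sin de; pose y1 := w1 * cos de - v1 * sin de.
have y2 : w2 * cos de - v2 * sin de = 0 by rewrite v2E w2E; ring.
have yy : y0 ^+ 2 + y1 ^+ 2 = 1.
  transitivity ((w0 * w0 + w1 * w1 + w2 * w2) * cos de ^+ 2
    + (v0 * v0 + v1 * v1 + v2 * v2) * sin de ^+ 2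
    - 2 * (v0 * w0 + v1 * w1 + v2 * w2) * (cos de * sin de)
    - (w2 * cos de - v2 * sin de) ^+ 2); first by rewrite /y0 /y1; ring.
  by rewrite ww vv vw y2 !mul1r cs; ring.
have xy : x0 * y0 + x1 * y1 = 0.
  transitivity ((w0 * w0 + w1 * w1 + w2 * w2) * (cos de * sin de)
    - (v0 * v0 + v1 * v1 + v2 * v2) * (cos de * sin de)
    + (v0 * w0 + v1 * w1 + v2 * w2) * (cos de ^+ 2 - sin de ^+ 2)
    - (v2 * cos de + w2 * sin de) * (w2 * cos de - v2 * sin de)).
    by rewrite /x0 /x1 /y0 /y1; ring.
  by rewrite ww vv vw y2; ring.
have kaxy : ka = x0 * y1 - x1 * y0.
  by rewrite -[LHS]mulr1 -cs /ka /x0 /x1 /y0 /y1; ring.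
have [al []] := polar_exists y1 (- y0).
rewrite sqrrN addrC yy sqrtr1 !mul1r => y1E y0E.
have x0E : x0 = ka * cos al.
  rewrite -y1E kaxy; transitivity (x0 * (y0 ^+ 2 + y1 ^+ 2) -
    y0 * (x0 * y0 + x1 * y1)); last by ring.
  by rewrite yy xy; ring.
have x1E : x1 = ka * sin al.
  rewrite -y0E kaxy; transitivity (x1 * (y0 ^+ 2 + y1 ^+ 2) -
    y1 * (x0 * y0 + x1 * y1)); last by ring.
  by rewrite yy xy; ring.
exists ka, de, al; split.
  by rewrite -subr_ge0 kaE addr_ge0// sqr_ge0.
have rot a b t : a * cos t + b * sin t =
    (a * cos de + b * sin de) * cos (t - de) +
    (b * cos de - a * sin de) * sin (t - de).
  transitivity ((a * cos t + b * sin t) * (cos de ^+ 2 + sin de ^+ 2)).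
    by rewrite cs mulr1.
  by rewrite cosB sinB; ring.
move=> t; split.
- by rewrite rot -/x0 -/y0 x0E -y0E mulNr opprK.
- by rewrite rot -/x1 -/y1 x1E y1E.
rewrite rot y2 mul0r addr0; congr (_ * _).
transitivity (rho * (cos de ^+ 2 + sin de ^+ 2)); first by rewrite v2E w2E; ring.
by rewrite cs mulr1.
Qed.

Lemma cos_sin_shift (j : int) (a : R) : exists s : R,
    [/\ s != 0, cos (a + j%:~R * pi) = s * cos a &
     sin (a + j%:~R * pi) = s * sin a].
Proof.
have nat_case (n : nat) (b : R) :
    cos (b + n%:R * pi) = (-1) ^+ n * cos b /\
    sin (b + n%:R * pi) = (-1) ^+ n * sin b.
  elim: n b => [|n IH] b; first by rewrite mul0r addr0 expr0 !mul1r.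
  rewrite -addn1 natrD mulrDl mul1r addrA cosDpi sinDpi (IH b).1 (IH b).2.
  by rewrite exprD expr1 mulrN1 !mulNr.
have sg0 (n : nat) : (-1) ^+ n != 0 :> R by rewrite expf_neq0// oppr_eq0 oner_eq0.
case: j => n; first by exists ((-1) ^+ n); have [] := nat_case n a.
exists ((-1) ^+ n.+1)^-1; rewrite NegzE mulrNz mulNr.
have [c1 s1] := nat_case n.+1 (a - n.+1%:R * pi).
rewrite !subrK in c1 s1.
by rewrite invr_eq0 c1 s1 !mulKf.
Qed.

Lemma atan_branch (t T : R) : cos t != 0 -> sin t = T * cos t ->
  exists k : int, t = atan T + k%:~R * pi.
Proof.
move=> c0 sE.
have pi0 : 0 < pi :> R := pi_gt0 R.
pose k := Num.floor ((t + pi / 2) / pi); exists k.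
have /andP[k1 k2] : k%:~R <= (t + pi / 2) / pi < (k + 1)%:~R.
  by rewrite /k real_floor_itv ?num_real.
rewrite ler_pdivlMr// in k1; rewrite ltr_pdivrMr// intrD mulr1z in k2.
have kpi : (k%:~R + 1) * pi = k%:~R * pi + pi :> R by ring.
rewrite kpi in k2.
have [s [s0 cs ss]] := cos_sin_shift (- k) t.
rewrite mulrNz mulNr in cs ss.
have cr0 : cos (t - k%:~R * pi) != 0 by rewrite cs mulf_neq0.
have tr : tan (t - k%:~R * pi) = T.
  by rewrite /tan cs ss sE; field; rewrite s0 c0.
have rI : t - k%:~R * pi \in `](- (pi / 2)), (pi / 2)[.
  rewrite in_itv/=; apply/andP; split; last by lra.
  rewrite lt_def; apply/andP; split; last by lra.
  by apply: contra_neq cr0 => ->; rewrite cosN cos_pihalf.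
by rewrite -tr tanK// subrK.
Qed.

End Circle.

(** * Smooth functions of several variables *)

Section CkClosure.
Variables (R : realType) (m : nat).
Implicit Types (V : normedModType R).
Local Notation T := ([set: 'rV[R]_m]).

Lemma Ck_sub k V (W : set 'rV[R]_m) (f : 'rV[R]_m -> V) : Ck k T f -> Ck k W f.
Proof.
elim: k f => [|k IH] f; first by move=> fc y _; exact: fc.
by move=> [fd f1]; split=> [y _|i]; [exact: (fd y Logic.I)|apply: IH; exact: f1].
Qed.

Lemma Ck_pred k V (f : 'rV[R]_m -> V) : Ck k.+1 T f -> Ck k T f.
Proof.
elim: k f => [|k IH] f [fd f1].
  by move=> y Ty; apply: differentiable_continuous; exact: (fd y Ty).
by split=> // i; exact: IH.
Qed.

Lemma Ck_cst k V (v : V) : Ck k T (fun _ : 'rV[R]_m => v).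
Proof.
elim: k v => [|k IH] v; first by move=> y _; exact: cst_continuous.
split=> [y _|i]; first exact: differentiable_cst.
rewrite (_ : partial i _ = fun=> 0) ; first exact: IH.
by apply/funext => y; rewrite /partial derive_cst.
Qed.

Lemma CkD k V (f g : 'rV[R]_m -> V) : Ck k T f -> Ck k T g ->
  Ck k T (fun y => f y + g y).
Proof.
elim: k f g => [|k IH] f g.
  by move=> fc gc y Ty; apply: continuousD; [exact: (fc y Ty)|exact: (gc y Ty)].
move=> [fd f1] [gd g1]; split=> [y Ty|i].
  by apply: differentiableD; [exact: (fd y Logic.I)|exact: (gd y Logic.I)].
rewrite (_ : partial i _ = fun y => partial i f y + partial i g y).
  by apply: IH; [exact: f1|exact: g1].
apply/funext => y; apply: deriveD; apply: diff_derivable.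
  exact: (fd y Logic.I).
exact: (gd y Logic.I).
Qed.

Lemma CkZr k V (f : 'rV[R]_m -> R) (v : V) : Ck k T f ->
  Ck k T (fun y => f y *: v).
Proof.
elim: k f => [|k IH] f.
  move=> fc y Ty.
  apply: (@continuous_comp _ _ _ f (fun k : R => k *: v) y).
    exact: (fc y Ty).
  exact: scalel_continuous.
move=> [fd f1]; split=> [y Ty|i].
  by apply: differentiableZl; exact: (fd y Ty).
rewrite (_ : partial i _ = fun y => partial i f y *: v).
  by apply: IH; exact: f1.
apply/funext => y; rewrite /partial deriveE; last exact/differentiableZl/(fd y Logic.I).
by rewrite diffZl ?deriveE//; exact: (fd y Logic.I).
Qed.

Lemma CkM k (f g : 'rV[R]_m -> R) : Ck k T f -> Ck k T g ->
  Ck k T (fun y => f y * g y).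
Proof.
elim: k f g => [|k IH] f g.
  by move=> fc gc y Ty; exact: (continuousM (fc y Ty) (gc y Ty)).
move=> fk gk; have [fd f1] := fk; have [gd g1] := gk.
split=> [y Ty|i]; first by apply: differentiableM; [exact: (fd y Logic.I)|exact: (gd y Logic.I)].
rewrite (_ : partial i _ =
  fun y => f y * partial i g y + g y * partial i f y).
  by apply: CkD; apply: IH; [exact: Ck_pred|exact: g1|exact: Ck_pred|exact: f1].
apply/funext => y; apply: deriveM; apply: diff_derivable.
  exact: (fd y Logic.I).
exact: (gd y Logic.I).
Qed.

Lemma partial_R1 (phi dphi : R -> R) (j i : 'I_m) :
  (forall t : R, is_derive t 1 phi (dphi t)) ->
  partial i (fun y : 'rV[R]_m => phi (y 0 j)) =
  fun y => (delta_mx 0 i : 'rV[R]_m) 0 j * dphi (y 0 j).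
Proof.
move=> pd; apply/funext => y.
have yd := is_derive_coord 0 j (is_derive_id y (delta_mx 0 i)).
have [_] := is_deriveR1 (f := fun y : 'rV[R]_m => y 0 j) (pd (y 0 j)) yd.
by rewrite mulrC.
Qed.

Lemma differentiable_coord_R1 (phi dphi : R -> R) (j : 'I_m) y :
  (forall t : R, is_derive t 1 phi (dphi t)) ->
  differentiable (fun y : 'rV[R]_m => phi (y 0 j)) y.
Proof.
move=> pd; apply: (differentiable_R1 (f := fun y : 'rV[R]_m => y 0 j) (pd _)).
exact: differentiable_coord.
Qed.

Lemma Ck_exp k (c : R) j : Ck k T (fun y : 'rV[R]_m => expR (c * y 0 j)).
Proof.
have ed (t : R) : is_derive t 1 (fun t : R => expR (c * t)) (c * expR (c * t)).
  have d := is_deriveZ c (is_derive_id t 1).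
  apply: is_derive_eq
    (is_deriveR1 (f := fun t : R => c * t) (is_derive_expR _) d) _.
  by rewrite mulrC; congr (_ * _); rewrite [LHS]mulr1.
elim: k => [|k IH].
  by move=> y _; apply/differentiable_continuous/(differentiable_coord_R1 _ _ ed).
split=> [y _|i]; first exact: (differentiable_coord_R1 _ _ ed).
rewrite (partial_R1 _ _ ed).
by apply: CkM; [exact: Ck_cst|apply: CkM; [exact: Ck_cst|exact: IH]].
Qed.

Lemma Ck_sin_cos k j : Ck k T (fun y : 'rV[R]_m => sin (y 0 j)) /\
  Ck k T (fun y : 'rV[R]_m => cos (y 0 j)).
Proof.
have sd (t : R) : is_derive t 1 (@sin R) (cos t) by exact: is_derive_sin.
have cd (t : R) : is_derive t 1 (@cos R) (- 1 * sin t) by rewrite mulN1r; exact: is_derive_cos.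
elim: k => [|k [IHs IHc]].
  split=> y _; apply: differentiable_continuous.
    exact: (differentiable_coord_R1 _ _ sd).
  exact: (differentiable_coord_R1 _ _ cd).
split; split=> [y _|i].
- exact: (differentiable_coord_R1 _ _ sd).
- by rewrite (partial_R1 _ _ sd); apply: CkM; [exact: Ck_cst|exact: IHc].
- exact: (differentiable_coord_R1 _ _ cd).
- rewrite (partial_R1 _ _ cd).
  by apply: CkM; [exact: Ck_cst|apply: CkM; [exact: Ck_cst|exact: IHs]].
Qed.

End CkClosure.

(** * The chart by colatitude and polar angle *)

Section PolarChart.
Variables (R : realType) (F : finsleroid_space R) (x : 'rV[R]_3).
Hypothesis hx : dom F x.
Variable (E : 'M[R]_3).
Hypothesis hE : adapted_frame F x E.

Local Notation g := (fg F x).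
Local Notation h := (fh F x).
Local Notation q := (fq F x).
Local Notation S := (indicatrix F x).
Local Notation fr k y := (frame_comp E y 0 k).

(** In the plane with coordinates [A] and [h q], the indicatrix is the
    logarithmic spiral of radius [exp (spiral_rate * f)] at the polar angle [f]. *)
Definition spiral_rate : R := g / (2 * h).

(** The point of the indicatrix with colatitude [u 0 0] on the sphere and polar
    angle [u 0 1]: the components are read off from [A = e cos f],
    [h q = e sin f] with [e = exp (spiral_rate * f)]. *)
Definition polar_chart (u : 'rV[R]_2) : 'rV[R]_3 :=
  (h^-1 * (expR (spiral_rate * u 0 0) * (sin (u 0 0) * cos (u 0 1)))) *: row 0 E +
  (h^-1 * (expR (spiral_rate * u 0 0) * (sin (u 0 0) * sin (u 0 1)))) *: row 1 E +
  (expR (spiral_rate * u 0 0) * (cos (u 0 0) + - spiral_rate * sin (u 0 0))) *: row ord_max E.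

Definition polar_point (f p : R) : 'rV[R]_2 := \row_j [:: f; p]`_j.

Lemma frame_row (k j : 'I_3) : fr j (row k E) = (k == j)%:R.
Proof.
by rewrite /frame_comp -row_mul mulmxV ?(frame_unit hE)// !mxE.
Qed.

Lemma frame_comb (a b c : R) j :
  fr j (a *: row 0 E + b *: row 1 E + c *: row ord_max E) =
  a * (0 == j :> 'I_3)%:R + b * (1 == j :> 'I_3)%:R + c * (ord_max == j)%:R.
Proof.
rewrite -addrA frame_linear frame_linear -[c *: _]addr0 frame_linear !frame_row.
have -> : frame_comp E 0 = 0 by rewrite /frame_comp mul0mx.
by rewrite mxE addr0 addrA.
Qed.

Lemma polar_chart_frame u :
  [/\ fr 0 (polar_chart u) =
        h^-1 * (expR (spiral_rate * u 0 0) * (sin (u 0 0) * cos (u 0 1))),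
      fr 1 (polar_chart u) =
        h^-1 * (expR (spiral_rate * u 0 0) * (sin (u 0 0) * sin (u 0 1))) &
      b_form F x (polar_chart u) =
        expR (spiral_rate * u 0 0) * (cos (u 0 0) + - spiral_rate * sin (u 0 0))].
Proof.
rewrite (b_form_frame hx hE) /polar_chart !frame_comb.
by split; rewrite /= !(mulr1, mulr0, addr0, add0r).
Qed.

Lemma polar_chart_Ck k (W : set 'rV[R]_2) : Ck k W polar_chart.
Proof.
apply: Ck_sub.
have [s0 c0] := @Ck_sin_cos R 2 k 0; have [s1 c1] := @Ck_sin_cos R 2 k 1.
have e0 := @Ck_exp R 2 k spiral_rate 0.
apply: CkD; last first.
  apply: CkZr; apply: CkM => //; apply: CkD => //.
  by apply: CkM => //; exact: Ck_cst.
by apply: CkD; apply: CkZr; apply: CkM; (try exact: Ck_cst);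
  apply: CkM => //; apply: CkM.
Qed.

Section AtPoint.
Variable (u : 'rV[R]_2).
Hypothesis u0 : 0 < u 0 0 < pi.
Local Notation e := (expR (spiral_rate * u 0 0)).

Let h0 : 0 < h. Proof. exact: fh_gt0. Qed.
Let sin0 : 0 < sin (u 0 0). Proof. exact: sin_gt0_pi. Qed.

Lemma polar_chart_q : q (polar_chart u) = h^-1 * (e * sin (u 0 0)).
Proof.
have [f0 f1 _] := polar_chart_frame u.
rewrite (fq_frame hx hE) f0 f1 (_ : _ + _ = (h^-1 * (e * sin (u 0 0))) ^+ 2).
  rewrite sqrtr_sqr ger0_norm//.
  by rewrite mulr_ge0 ?invr_ge0 ?(ltW h0)// mulr_ge0 ?expR_ge0// ltW.
transitivity ((h^-1 * (e * sin (u 0 0))) ^+ 2 *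
   (cos (u 0 1) ^+ 2 + sin (u 0 1) ^+ 2)); first by ring.
by rewrite cos2Dsin2 mulr1.
Qed.

Lemma polar_chart_q_neq0 : q (polar_chart u) != 0.
Proof.
rewrite polar_chart_q mulf_neq0 ?invr_eq0 ?(gt_eqF h0)//.
by rewrite mulf_neq0 ?(gt_eqF sin0)// gt_eqF// expR_gt0.
Qed.

Lemma polar_chart_A : fA F x (polar_chart u) = e * cos (u 0 0).
Proof.
have [_ _ bE] := polar_chart_frame u.
rewrite /fA bE polar_chart_q /spiral_rate.
by move: (expR _) (cos _) (sin _) => *; field; rewrite gt_eqF.
Qed.

Lemma polar_chart_sqrtB : Num.sqrt (fB F x (polar_chart u)) = e.
Proof.
rewrite (fBE hx) polar_chart_q polar_chart_A.
transitivity (Num.sqrt (e ^+ 2)).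
  congr Num.sqrt; rewrite -[RHS]mulr1 -(cos2Dsin2 (u 0 0)).
  by move: (expR _) (cos _) (sin _) => *; field; rewrite gt_eqF.
by rewrite sqrtr_sqr ger0_norm// expR_ge0.
Qed.

Lemma polar_chart_indicatrix : S (polar_chart u).
Proof.
rewrite /indicatrix/= /finsler_K polar_chart_sqrtB /chi /ff polar_chart_A.
have e0 : e != 0 by rewrite gt_eqF// expR_gt0.
rewrite polar_chart_sqrtB [e * cos _]mulrC mulfK// cosK; last first.
  by rewrite in_itv/=; case/andP: u0 => /ltW-> /ltW->.
rewrite -expRD (_ : _ + _ = 0) ?expR0// /spiral_rate.
by field; rewrite gt_eqF.
Qed.

Lemma polar_chart_sphere k : sphere_map F x E k (polar_chart u) =
  triple (sin (u 0 0) * cos (u 0 1)) (sin (u 0 0) * sin (u 0 1)) (cos (u 0 0)) k.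
Proof.
have [f0 f1 _] := polar_chart_frame u.
have e0 : e != 0 by rewrite gt_eqF// expR_gt0.
rewrite /sphere_map f0 f1 polar_chart_A polar_chart_sqrtB.
have hK : h != 0 by rewrite gt_eqF.
congr triple.
- by rewrite (mulVKf hK) [e * _]mulrC mulfK.
- by rewrite (mulVKf hK) [e * _]mulrC mulfK.
- by rewrite [e * _]mulrC mulfK.
Qed.

End AtPoint.

Definition polar_domain (p0 : R) : set 'rV[R]_2 :=
  [set u | [/\ 0 < u 0 0, u 0 0 < pi, - (pi / 2) < u 0 1 - p0
    & u 0 1 - p0 < pi / 2]].

Lemma polar_domain_open p0 : open (polar_domain p0).
Proof.
have co (j : 'I_2) : continuous (fun u : 'rV[R]_2 => u 0 j) by exact: coord_continuous.
have cop (j : 'I_2) (A : set R) : open A -> open [set u : 'rV[R]_2 | A (u 0 j)].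
  by move=> Ao; exact: (open_comp (fun u _ => co j u) Ao).
rewrite (_ : polar_domain p0 =
  ([set u : 'rV[R]_2 | [set t | 0 < t] (u 0 0)] `&`
   [set u : 'rV[R]_2 | [set t | t < pi] (u 0 0)]) `&`
  ([set u : 'rV[R]_2 | [set t | p0 - pi / 2 < t] (u 0 1)] `&`
   [set u : 'rV[R]_2 | [set t | t < p0 + pi / 2] (u 0 1)])).
  apply: openI; apply: openI; apply: cop.
  - exact: open_gt.
  - exact: open_lt.
  - exact: open_gt.
  - exact: open_lt.
apply/seteqP; split=> u /=.
  by move=> [? ? ? ?]; split; split=> //=; lra.
by move=> [[? ?] [? ?]]; split=> //; lra.
Qed.

Lemma polar_chart_inj p0 u v : polar_domain p0 u -> polar_domain p0 v ->
  polar_chart u = polar_chart v -> u = v.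
Proof.
move=> [u0 u1 u2 u3] [v0 v1 v2 v3] uv.
have up : 0 < u 0 0 < pi by rewrite u0. have vp : 0 < v 0 0 < pi by rewrite v0.
have sE k := congr1 (sphere_map F x E k) uv.
have E0 : u 0 0 = v 0 0.
  have := sE ord_max; rewrite !polar_chart_sphere// /triple/=.
  by apply: cos_inj; rewrite in_itv/= ltW//= ltW.
have s0 : sin (v 0 0) != 0 by rewrite gt_eqF// sin_gt0_pi.
have C : cos (u 0 1) = cos (v 0 1).
  by have := sE 0; rewrite !polar_chart_sphere// /triple/= E0 => /(mulfI s0).
have D : sin (u 0 1) = sin (v 0 1).
  by have := sE 1; rewrite !polar_chart_sphere// /triple/= E0 => /(mulfI s0).
have E1 : u 0 1 = v 0 1.
  apply: (addIr (- p0)); apply: sin_inj; rewrite ?in_itv/= ?ltW//.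
  by rewrite !sinB C D.
apply/matrixP => i j; rewrite (ord1 i); case: j => [[|[|//]]] jj.
- by rewrite (_ : Ordinal jj = 0)//; apply/val_inj.
- by rewrite (_ : Ordinal jj = 1)//; apply/val_inj.
Qed.

(** Seen on the sphere, the coordinate vectors are those of colatitude and
    longitude, which are independent because [sin f] does not vanish. *)
Lemma polar_chart_free p0 u : polar_domain p0 u ->
  row_free (\matrix_(a < 2) partial a polar_chart u).
Proof.
move=> Du; have [u0 u1 u2 u3] := Du.
have up : 0 < u 0 0 < pi by rewrite u0.
have q0 := polar_chart_q_neq0 up.
have Yd : differentiable polar_chart u.
  exact: ((polar_chart_Ck 1 setT).1 u Logic.I).
rewrite -kermx_eq0; apply/rowV0P => al /sub_kermxP al0.
have dY : is_derive u al polar_chart 0.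
  apply: is_derive_eq (derivableP (diff_derivable Yd)) _.
  rewrite derive_delta_sum// -[RHS]al0; apply/matrixP => i j.
  by rewrite (ord1 i) summxE !mxE; apply: eq_bigr => a _; rewrite !mxE.
pose sph (k : 'I_3) (v : 'rV[R]_2) := triple (sin (v 0 0) * cos (v 0 1))
    (sin (v 0 0) * sin (v 0 1)) (cos (v 0 0)) k.
have sph0 k : 'D_al (sph k) u = 0.
  have sd := is_diff_sphere hx hE k q0.
  have [_ <-] : is_derive u al (fun v => sphere_map F x E k (polar_chart v)) 0.
    apply: is_derive_eq (is_derive_chain dY (ex_diff (is_diff_def := sd))) _.
    by rewrite derive0.
  have nE : \forall v \near u, sph k v = sphere_map F x E k (polar_chart v).
    have nD : nbhs u (polar_domain p0).
      by apply: open_nbhs_nbhs; split; [exact: polar_domain_open|].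
    by apply: near_imp nD => v [v0 v1 _ _]; rewrite polar_chart_sphere ?v0.
  exact: near_eq_derive nE.
have dc j : is_derive u al (fun v : 'rV[R]_2 => v 0 j) (al 0 j).
  exact: is_derive_coord 0 j (is_derive_id u al).
have dcos j : is_derive u al (fun v : 'rV[R]_2 => cos (v 0 j))
    (- sin (u 0 j) * al 0 j).
  exact: (is_deriveR1 (f := fun v : 'rV[R]_2 => v 0 j) (is_derive_cos _) (dc j)).
have dsin j : is_derive u al (fun v : 'rV[R]_2 => sin (v 0 j))
    (cos (u 0 j) * al 0 j).
  exact: (is_deriveR1 (f := fun v : 'rV[R]_2 => v 0 j) (is_derive_sin _) (dc j)).
have s0 : sin (u 0 0) != 0 by rewrite gt_eqF// sin_gt0_pi.
have a0 : al 0 0 = 0.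
  have := sph0 ord_max; rewrite /sph /triple/=; have [_ ->] := dcos 0.
  by move=> /eqP; rewrite mulf_eq0 oppr_eq0 (negPf s0)/= => /eqP.
have a1c : cos (u 0 1) * al 0 1 = 0.
  have := sph0 1; rewrite /sph /triple/=.
  have [_ ->] := is_derive_mulf (dsin 0) (dsin 1).
  rewrite a0 !mulr0 addr0 => /eqP.
  by rewrite mulf_eq0 (negPf s0)/= => /eqP.
have a1s : sin (u 0 1) * al 0 1 = 0.
  have := sph0 0; rewrite /sph /triple/=.
  have [_ ->] := is_derive_mulf (dsin 0) (dcos 1).
  rewrite a0 !mulr0 addr0 => /eqP.
  by rewrite mulf_eq0 (negPf s0)/= mulNr oppr_eq0 => /eqP.
have a1 : al 0 1 = 0.
  rewrite -[LHS]mul1r -(cos2Dsin2 (u 0 1)) mulrDl !expr2 -!mulrA a1c a1s.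
  by rewrite !mulr0 addr0.
apply/matrixP => i j; rewrite (ord1 i) [RHS]mxE; case: j => [[|[|//]]] jj.
- by rewrite (_ : Ordinal jj = 0)//; apply/val_inj.
- by rewrite (_ : Ordinal jj = 1)//; apply/val_inj.
Qed.

Lemma polar_local_chart p0 : local_chart S (polar_domain p0) polar_chart.
Proof.
split.
- exact: polar_domain_open.
- exact: polar_chart_Ck.
- by move=> u [u0 u1 _ _]; apply: polar_chart_indicatrix; rewrite u0.
- exact: polar_chart_inj.
- exact: polar_chart_free.
Qed.

Lemma polar_chart_onto y p : S y -> q y != 0 ->
  fr 0 y = q y * cos p -> fr 1 y = q y * sin p ->
  0 < ff F x y < pi /\ y = polar_chart (polar_point (ff F x y) p).
Proof.
move=> Sy q0 f0 f1.
have h0 : 0 < h by exact: fh_gt0.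
have /andP[ul ur] := cos_bound hx q0.
have fI : 0 < ff F x y < pi.
  by rewrite /ff acos_gt0 ?acos_ltpi ?ul ?ur ?(ltW ul) ?(ltW ur).
split=> //.
have B0 : 0 < Num.sqrt (fB F x y) by rewrite sqrtr_gt0 (fB_gt0 hx).
have cosE : cos (ff F x y) = fA F x y / Num.sqrt (fB F x y).
  by rewrite /ff acosK// in_itv/= !ltW.
have sinE : sin (ff F x y) = h * q y / Num.sqrt (fB F x y).
  by rewrite /ff sin_acos ?(sqrt_sub_cos hx)// !ltW.
have eE : expR (spiral_rate * ff F x y) = Num.sqrt (fB F x y).
  have : finsler_K F x y = 1 := Sy.
  rewrite /finsler_K expRN /chi => /(congr1 ( *%R^~ (expR (spiral_rate * ff F x y)))).
  rewrite (_ : 2^-1 * g * (ff F x y / h) = spiral_rate * ff F x y).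
    by rewrite mulfVK ?gt_eqF ?expR_gt0// mul1r.
  by rewrite /spiral_rate; field; rewrite gt_eqF.
rewrite -[LHS](frame_compK hE) -[RHS](frame_compK hE); congr (_ *m E).
have [c0 c1 c2] := polar_chart_frame (polar_point (ff F x y) p).
have p0E : polar_point (ff F x y) p 0 0 = ff F x y by rewrite mxE.
have p1E : polar_point (ff F x y) p 0 1 = p by rewrite mxE.
rewrite p0E p1E eE cosE sinE in c0 c1 c2.
apply/matrixP => i j; rewrite (ord1 i); case: j => [[|[|[|//]]]] jj.
- rewrite (_ : Ordinal jj = 0); last exact/val_inj.
  rewrite c0 f0; move: (Num.sqrt _) B0 (q y) => s s0 r.
  by field; rewrite !gt_eqF.
- rewrite (_ : Ordinal jj = 1); last exact/val_inj.
  rewrite c1 f1; move: (Num.sqrt _) B0 (q y) => s s0 r.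
  by field; rewrite !gt_eqF.
- rewrite (_ : Ordinal jj = ord_max); last exact/val_inj.
  rewrite -!(b_form_frame hx hE) c2 /fA /spiral_rate.
  move: (Num.sqrt _) B0 (q y) (b_form F x y) => s s0 r b.
  by field; rewrite !gt_eqF.
Qed.

End PolarChart.

(** * Continuous determinations of an angle *)

Section AngleLemmas.
Variables (R : realType) (I : set R).
Hypothesis I_open : open I.
Hypothesis I_itv : is_interval I.

Lemma is_derive1_continuous (f : R -> R) (s df : R) :
  is_derive s 1 f df -> {for s, continuous f}.
Proof.
by move=> [fd _]; apply: differentiable_continuous; exact/derivable1_diffP.
Qed.

(** Otherwise [phi] would take a value [phi a + e] with [0 < |e| < pi], and the
    cosine does not vanish there. *)
Lemma const_of_cos0 (phi : R -> R) (al : R) :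
  (forall s, I s -> {for s, continuous phi}) ->
  (forall s, I s -> cos (phi s - al) = 0) ->
  forall a b, I a -> I b -> phi a = phi b.
Proof.
move=> pc c0 a b Ia Ib; apply/eqP; apply: contraT => ab.
(* a step of the same sign as [d], no longer than [d] and shorter than 1 *)
pose d := phi b - phi a; pose e := d / (1 + `|d|).
have d0 : d != 0 by rewrite subr_eq0 eq_sym.
have n0 : 0 < 1 + `|d| by rewrite ltr_pwDl.
have e0 : e != 0 by rewrite mulf_neq0// invr_eq0 gt_eqF.
have eE : e * (1 + `|d|) = d by rewrite /e divfK// gt_eqF.
have dn := normr_ge0 d.
have [t It phit] : exists2 t, I t & phi t = phi a + e.
  apply: (interval_value I_itv pc Ia Ib).
  have : phi b = phi a + d by rewrite /d addrC subrK.
  rewrite ge_min le_max => ->; apply/andP; split; apply/orP.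
    have [ep|en] := leP 0 e; [by left; lra|right; nra].
  have [ep|en] := leP 0 e; [by right; nra|left; lra].
have se : sin e = 0.
  have ca := c0 a Ia; have := c0 t It.
  rewrite phit addrAC cosD ca mul0r sub0r => /eqP.
  rewrite oppr_eq0 mulf_eq0 => /orP[/eqP sa|/eqP//].
  have := cos2Dsin2 (phi a - al); rewrite ca sa !expr0n/= addr0 => /esym/eqP.
  by rewrite oner_eq0.
have e1 : `|e| < 1.
  rewrite /e normf_div (gtr0_norm n0) ltr_pdivrMr// mul1r; lra.
have sne : 0 < sin `|e|.
  apply: sin_gt0_pi; rewrite normr_gt0 e0/=; apply: lt_le_trans e1 _.
  by have := pi_ge2 R; lra.
move: sne; have [ep|en] := leP 0 e; first by rewrite ger0_norm// se ltxx.
by rewrite ltr0_norm// sinN se oppr0 ltxx.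
Qed.

(** Near [s] the angle is [th s + atan] of a quotient of linear combinations of
    [a] and [b], since it stays within [pi / 2] of [th s] by continuity. *)
Lemma is_derive_angle (th a b sg : R -> R) (s da db : R) : I s ->
  (forall s, I s -> {for s, continuous th}) ->
  (forall s, I s -> 0 < sg s) ->
  (forall s, I s -> a s = sg s * cos (th s)) ->
  (forall s, I s -> b s = sg s * sin (th s)) ->
  is_derive s 1 a da -> is_derive s 1 b db ->
  is_derive s 1 th ((a s * db - b s * da) / sg s ^+ 2).
Proof.
move=> Is thc sg0 aE bE ad bd.
pose cs := cos (th s); pose sn := sin (th s).
have csn : cs ^+ 2 + sn ^+ 2 = 1 by exact: cos2Dsin2.
pose N t := b t * cs - a t * sn; pose D t := a t * cs + b t * sn.
have Ns : N s = 0 by rewrite /N aE// bE// -/cs -/sn; ring.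
have Ds : D s = sg s.
  by rewrite /D aE// bE// -/cs -/sn -[RHS]mulr1 -csn; ring.
have D0 : D s != 0 by rewrite Ds gt_eqF// sg0.
have Nd : is_derive s 1 N (db * cs - da * sn).
  apply: is_derive_eq (is_deriveB (is_derive_mulf bd (is_derive_cst cs s 1))
    (is_derive_mulf ad (is_derive_cst sn s 1))) _.
  by rewrite !mulr0 !add0r mulrC [da * _]mulrC.
have Dd : is_derive s 1 D (da * cs + db * sn).
  apply: is_derive_eq (is_deriveD (is_derive_mulf ad (is_derive_cst cs s 1))
    (is_derive_mulf bd (is_derive_cst sn s 1))) _.
  by rewrite !mulr0 !add0r mulrC [db * _]mulrC.
have Td := is_derive_mulf Nd (is_deriveV D0 Dd).
rewrite Ns mul0r add0r in Td.
have Ad := is_deriveR1 (f := fun t => N t * (D t)^-1) (is_derive1_atan _) Td.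
have Fd := is_deriveD (is_derive_cst (th s) s 1) Ad.
apply: near_eq_is_derive (is_derive_eq Fd _).
  have Is' := open_nbhs_nbhs (conj I_open Is).
  have close : \forall t \near s, `|th s - th t| < 1.
    by have /cvgrPdist_lt/(_ 1 ltr01) := thc s Is.
  apply: near_imp2 Is' close => t It tht.
  have pi2 : 1 <= pi / 2 :> R by exact: pihalf_ge1.
  move: tht; rewrite distrC ltr_norml => /andP[t1 t2].
  have tI : th t - th s \in `](- (pi / 2)), (pi / 2)[ by rewrite in_itv/=; apply/andP; split; lra.
  change (th s + atan (N t * (D t)^-1) = th t).
  rewrite (_ : N t * (D t)^-1 = tan (th t - th s)).
    by rewrite tanK// addrC subrK.
  rewrite /tan /N /D aE// bE// cosB sinB -/cs -/sn.
  have s0 := sg0 t It; have c0 : 0 < cos (th t - th s).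
    by apply: cos_gt0_pihalf; move: tI; rewrite in_itv.
  rewrite cosB -/cs -/sn in c0.
  move: (sg t) (cos (th t)) (sin (th t)) s0 c0 => r c1 s1 s0 c0.
  rewrite (_ : r * s1 * cs - _ = r * (s1 * cs - c1 * sn)); last by ring.
  rewrite (_ : r * c1 * cs + _ = r * (c1 * cs + s1 * sn)); last by ring.
  by rewrite -mulf_div divff ?mul1r// gt_eqF.
rewrite add0r Ns mul0r expr0n/= addr0 invr1 mul1r Ds (aE s Is) (bE s Is) -/cs -/sn.
have := sg0 s Is; move: (sg s) => r r0.
by field; rewrite gt_eqF.
Qed.

(** Away from the poles of the tangent the relation holds for every branch of the
    arctangent.  If it failed at a pole, it would fail nearby by continuity, so
    all nearby points would be poles; but the zeros of the cosine are isolated. *)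
Lemma branch_relation (ka h s0 : R) (th : R -> R) : h != 0 -> ka != 0 ->
  (forall s, I s -> {for s, continuous th}) ->
  (forall s, I s -> cos (h * (s - s0)) != 0 ->
     exists k : int, th s = atan (ka^-1 * tan (h * (s - s0))) + k%:~R * pi) ->
  forall s, I s ->
    sin (th s) * (ka * cos (h * (s - s0))) = cos (th s) * sin (h * (s - s0)).
Proof.
move=> h0 ka0 thc br s Is.
pose Z t := sin (th t) * (ka * cos (h * (t - s0))) - cos (th t) * sin (h * (t - s0)).
have Z0 t : I t -> cos (h * (t - s0)) != 0 -> Z t = 0.
  move=> It c0; have [k thE] := br t It c0; rewrite /Z thE.
  set T := ka^-1 * _; have [r [r0 -> ->]] := cos_sin_shift k (atan T).
  have ca : cos (atan T) != 0.
    by rewrite gt_eqF// cos_gt0_pihalf// atan_gtNpi2 atan_ltpi2.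
  have -> : sin (atan T) = T * cos (atan T) by rewrite -{2}[T]atanK /tan divfK.
  move: (cos (atan T)) => u; rewrite /T /tan.
  move: (sin (h * (t - s0))) (cos (h * (t - s0))) c0 => v w w0.
  by field; rewrite ka0 w0.
apply/eqP; rewrite -subr_eq0 -/(Z s); apply/negPn/negP => Zs.
have cd (t : R) := is_derive_cos_affine h s0 t.
have sd (t : R) := is_derive_sin_affine h s0 t.
have Zc : {for s, continuous Z}.
  have thcs : {for s, continuous (fun t => sin (th t))}.
    exact: (continuous_comp (thc s Is) (@continuous_sin R (th s))).
  have thcc : {for s, continuous (fun t => cos (th t))}.
    exact: (continuous_comp (thc s Is) (@continuous_cos R (th s))).
  apply: continuousB; apply: continuousM => //.
    by apply: continuousM; [exact: cst_continuous|exact: is_derive1_continuous (cd s)].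
  exact: is_derive1_continuous (sd s).
have Zn : \forall t \near s, Z t != 0.
  exact: (Zc _ (open_nbhs_nbhs (conj (open_neq (y := 0)) Zs))).
have Is' := open_nbhs_nbhs (conj I_open Is).
have cn : \forall t \near s, cos (h * (t - s0)) = 0.
  by apply: near_imp2 Zn Is' => t Zt It; apply/eqP; apply: contraNT Zt => /(Z0 t It)/eqP.
have [_] := cd s; rewrite (near_eq_derive _ cn) derive_cst => /esym/eqP.
rewrite oppr_eq0 mulf_eq0 (negPf h0)/= => /eqP sn0.
have := cos2Dsin2 (h * (s - s0)); rewrite (nbhs_singleton cn) sn0 expr0n/= addr0.
by move=> /esym/eqP; rewrite oner_eq0.
Qed.

(** The relation makes [(cos th, sin th)] parallel to [(ka cos t, sin t)], a
    vector of length [sg]; their scalar product does not vanish, so it keeps its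
    sign on the interval. *)
Lemma circle_of_angle (ka h s0 : R) (th sg : R -> R) :
  (forall s, I s -> {for s, continuous th}) ->
  (forall s, I s -> 0 < sg s) ->
  (forall s, I s -> sg s ^+ 2 =
     ka ^+ 2 * cos (h * (s - s0)) ^+ 2 + sin (h * (s - s0)) ^+ 2) ->
  (forall s, I s ->
    sin (th s) * (ka * cos (h * (s - s0))) = cos (th s) * sin (h * (s - s0))) ->
  exists2 e : R, e ^+ 2 = 1 & forall s, I s ->
    sg s * cos (th s) = e * (ka * cos (h * (s - s0))) /\
    sg s * sin (th s) = e * sin (h * (s - s0)).
Proof.
move=> thc sg0 sgE rel.
pose N t := cos (th t) * (ka * cos (h * (t - s0))) + sin (th t) * sin (h * (t - s0)).
have N2 t : I t -> N t ^+ 2 = sg t ^+ 2.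
  move=> It; rewrite sgE// /N; have r := rel t It; have cs := cos2Dsin2 (th t).
  move: r cs; move: (cos (th t)) (sin (th t)) (cos (h * _)) (sin (h * _)).
  move=> c1 s1 c2 s2 r cs.
  transitivity ((c1 ^+ 2 + s1 ^+ 2) * (ka ^+ 2 * c2 ^+ 2 + s2 ^+ 2)
    - (s1 * (ka * c2) - c1 * s2) ^+ 2); first by ring.
  by rewrite r cs subrr expr0n/= subr0 mul1r.
have Nc s : I s -> {for s, continuous N}.
  move=> Is.
  have thcs : {for s, continuous (fun t => sin (th t))}.
    exact: (continuous_comp (thc s Is) (@continuous_sin R (th s))).
  have thcc : {for s, continuous (fun t => cos (th t))}.
    exact: (continuous_comp (thc s Is) (@continuous_cos R (th s))).
  apply: continuousD; apply: continuousM => //.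
    by apply: continuousM; [exact: cst_continuous|
      exact: is_derive1_continuous (is_derive_cos_affine h s0 s)].
  exact: is_derive1_continuous (is_derive_sin_affine h s0 s).
have N0 s : I s -> N s != 0.
  by move=> Is; rewrite -sqrf_eq0 N2// sqrf_eq0 gt_eqF// sg0.
have [e e2 eN] := interval_sign I_itv Nc N0; exists e => // s Is.
have eNs : e * N s = sg s.
  apply/eqP; rewrite -(eqrXn2 (n := 2)) ?(ltW (eN s Is)) ?(ltW (sg0 s Is))//.
  by rewrite exprMn e2 mul1r N2.
have r := rel s Is; have g2 := sgE s Is; have g0 := sg0 s Is.
have eE : N s = e * sg s by rewrite -eNs mulrA -expr2 e2 mul1r.
move: r g2 g0 eE; rewrite /N.
move: (cos (th s)) (sin (th s)) (cos (h * _)) (sin (h * _)) (sg s).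
move=> c1 s1 c2 s2 G r g2 g0 eE.
split; apply: (mulfI (lt0r_neq0 g0)).
- transitivity (c1 * G ^+ 2); first by ring.
  rewrite g2; transitivity (ka * c2 * (e * G)); last by ring.
  rewrite -eE; transitivity (ka * c2 * (c1 * (ka * c2)) + c1 * s2 * s2); first by ring.
  by rewrite -r; ring.
- transitivity (s1 * G ^+ 2); first by ring.
  rewrite g2; transitivity (s2 * (e * G)); last by ring.
  rewrite -eE; transitivity (s1 * (ka * c2) * (ka * c2) + s1 * s2 ^+ 2); first by ring.
  by rewrite r; ring.
Qed.

End AngleLemmas.

(** * The angles along a geodesic *)

Section Geodesics.
Variables (R : realType) (F : finsleroid_space R) (x : 'rV[R]_3).
Hypothesis hx : dom F x.
Variable (E : 'M[R]_3).
Hypothesis hE : adapted_frame F x E.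
Variables (I : set R) (c : R -> 'rV[R]_3) (phi : R -> R).
Hypothesis I_open : open I.
Hypothesis I_itv : is_interval I.
Hypothesis hc : forall s, I s -> indicatrix F x (c s).
Hypothesis hq : forall s, I s -> fq F x (c s) != 0.
Hypothesis hphi : polar_angle_along F x E I c phi.

Local Notation h := (fh F x).
Local Notation q := (fq F x).
Local Notation G := (metric_tensor F x).
Local Notation S := (indicatrix F x).
Local Notation m := (fun k s => sphere_map F x E k (c s)).

Let h0 : h != 0. Proof. by rewrite gt_eqF// (fh_gt0 hx). Qed.

(** The sine of the colatitude: the distance to the axis of the image on the
    sphere. *)
Definition sphere_radius (y : 'rV[R]_3) : R := h * q y / Num.sqrt (fB F x y).

Lemma phi_continuous s : I s -> {for s, continuous phi}.
Proof. by have [+ _] := hphi; move=> /(within_open_continuous I_open); apply. Qed.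

Lemma sphere_radius_gt0 s : I s -> 0 < sphere_radius (c s).
Proof.
move=> Is; have q0 := hq Is.
rewrite /sphere_radius divr_gt0 ?sqrtr_gt0 ?(fB_gt0 hx)//.
by rewrite mulr_gt0 ?(fh_gt0 hx)// lt_def q0 fq_ge0.
Qed.

Lemma sphere_polar s : I s ->
  [/\ m 0 s = sphere_radius (c s) * cos (phi s),
      m 1 s = sphere_radius (c s) * sin (phi s) &
      chi F x (c s) = h^-1 * acos (m ord_max s)].
Proof.
move=> Is; have [_ /(_ s Is)[f0 f1]] := hphi.
split; last by rewrite /chi mulrC.
  by rewrite /sphere_map /triple/= f0 /sphere_radius; ring.
by rewrite /sphere_map /triple/= f1 /sphere_radius; ring.
Qed.

Lemma sphere_latitude s : I s -> -1 < m ord_max s < 1.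
Proof. by move=> Is; exact: (cos_bound hx (hq Is)). Qed.

Lemma sphere_radius2 s : I s ->
  sphere_radius (c s) ^+ 2 = 1 - m ord_max s ^+ 2.
Proof.
move=> Is; have := sphere_norm hx hE hq Is; rewrite sum_ord3.
have [-> -> _] := sphere_polar Is => <-.
rewrite -[LHS]mulr1 -(cos2Dsin2 (phi s)); ring.
Qed.

Definition angle_formulas (C s0 phi0 : R) : Prop :=
  [/\ h ^+ 2 * C ^+ 2 <= 1,
      forall s, I s ->
        chi F x (c s) =
        h^-1 * acos (Num.sqrt (1 - h ^+ 2 * C ^+ 2) * cos (h * (s - s0))),
      C != 0 ->
        exists theta : R -> R,
          arctan_branch I [set s | cos (h * (s - s0)) != 0]
            (fun s => (h * C)^-1 * tan (h * (s - s0))) theta /\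
          forall s, I s -> phi s = phi0 - pi / 2 + theta s
    & C = 0 -> forall s, I s -> phi s = phi0].

Lemma geodesic_angle_formulas : geodesic S G I c -> arc_length_param G I c ->
  exists C s0 phi0 : R, angle_formulas C s0 phi0.
Proof.
move=> geo arc.
have ode := geodesic_sphere_ode hx hE I_open hc hq geo arc.
have [[s1 Is1]|noI] := pselect (exists s, I s); last first.
  exists 0, 0, 0; split.
  - by rewrite expr0n/= mulr0.
  - by move=> s Is; case: noI; exists s.
  - by rewrite eqxx.
  - by move=> _ s Is; case: noI; exists s.
pose v k := m k s1; pose w k := derive1 (m k) s1 / h.
have [md1 md1' speed1] := ode s1 Is1.
have vv : \sum_k v k * v k = 1 by exact: (sphere_norm hx hE hq Is1).
have ww : \sum_k w k * w k = 1.
  transitivity ((h ^+ 2)^-1 * \sum_k derive1 (m k) s1 ^+ 2).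
    by rewrite mulr_sumr; apply: eq_bigr => k _; rewrite /w; move: (derive1 _ _) => ?; field.
  by rewrite speed1 mulVf// expf_neq0.
have vw : \sum_k v k * w k = 0.
  have n1 : \forall s \near s1, \sum_k m k s * m k s = 1.
    apply: near_imp (open_nbhs_nbhs (conj I_open Is1)) => s Is.
    exact: (sphere_norm hx hE hq Is).
  have := unit_vector_orth n1 md1.
  rewrite /v /w; under [in X in _ -> X]eq_bigr do rewrite mulrA derive1E.
  by rewrite -mulr_suml => ->; rewrite mul0r.
have sol k s : I s -> m k s = v k * cos (h * (s - s1)) + w k * sin (h * (s - s1)).
  move=> Is; apply: (harmonic_solution I_itv h0 Is1 _ _ Is (m := m k)).
    by move=> t It; have [] := ode t It.
  by move=> t It; have [] := ode t It.
have [ka [de [al [ka1 nf]]]] := great_circle_normal_form vv ww vw.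
pose C := ka / h; pose s0 := s1 + de / h.
have hC : h * C = ka by rewrite /C mulrC divfK.
have hC2 : h ^+ 2 * C ^+ 2 = ka ^+ 2 by rewrite -exprMn hC.
have ts s : h * (s - s0) = h * (s - s1) - de.
  by rewrite /s0; field.
have circ s : I s ->
    [/\ m 0 s = ka * cos al * cos (h * (s - s0)) - sin al * sin (h * (s - s0)),
        m 1 s = ka * sin al * cos (h * (s - s0)) + cos al * sin (h * (s - s0)) &
        m ord_max s = Num.sqrt (1 - ka ^+ 2) * cos (h * (s - s0))].
  by move=> Is; rewrite !(sol _ _ Is) ts; exact: nf.
have ang s : I s ->
    sphere_radius (c s) * cos (phi s - al) = ka * cos (h * (s - s0)) /\
    sphere_radius (c s) * sin (phi s - al) = sin (h * (s - s0)).
  move=> Is; have [c0 c1 _] := circ s Is; have [p0 p1 _] := sphere_polar Is.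
  rewrite p0 in c0; rewrite p1 in c1; rewrite cosB sinB.
  have csal := cos2Dsin2 al.
  split.
    transitivity ((sphere_radius (c s) * cos (phi s)) * cos al +
      (sphere_radius (c s) * sin (phi s)) * sin al); first by ring.
    rewrite c0 c1; transitivity (ka * cos (h * (s - s0)) * (cos al ^+ 2 + sin al ^+ 2)).
      by ring.
    by rewrite csal mulr1.
  transitivity ((sphere_radius (c s) * sin (phi s)) * cos al -
    (sphere_radius (c s) * cos (phi s)) * sin al); first by ring.
  rewrite c0 c1; transitivity (sin (h * (s - s0)) * (cos al ^+ 2 + sin al ^+ 2)).
    by ring.
  by rewrite csal mulr1.
(* on a meridian the constant value of [phi] is [al + pi / 2] only up to a
   multiple of [pi], so it is read off at a point of [I] *)
exists C, s0, (if ka == 0 then phi s1 else al + pi / 2).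
have C0 : (C == 0) = (ka == 0) by rewrite /C mulf_eq0 invr_eq0 (negPf h0) orbF.
split.
- by rewrite hC2.
- move=> s Is; have [_ _ ->] := sphere_polar Is; have [_ _ c2] := circ s Is.
  by rewrite hC2 -c2.
- rewrite C0 => ka0; rewrite (negPf ka0); exists (fun s => phi s - al); split.
    split.
      apply/(within_open_continuous I_open) => s Is.
      by apply: continuousB; [exact: phi_continuous|exact: cst_continuous].
    move=> s Is /= c0; have [ac as'] := ang s Is; rewrite hC.
    have r0 := sphere_radius_gt0 Is.
    apply: atan_branch.
      have : sphere_radius (c s) * cos (phi s - al) != 0 by rewrite ac mulf_neq0.
      by rewrite mulf_eq0 negb_or => /andP[].
    apply: (mulfI (lt0r_neq0 r0)); rewrite as' mulrCA ac /tan.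
    move: (sin _) (cos _) c0 => a b b0.
    by field; rewrite ka0 b0.
  by move=> s Is; ring.
- move=> /eqP; rewrite C0 => /eqP ka0; rewrite ka0 eqxx => s Is.
  apply: (const_of_cos0 I_itv phi_continuous _ Is Is1 (al := al)) => t It.
  have [+ _] := ang t It; rewrite ka0 mul0r => /eqP.
  by rewrite mulf_eq0 gt_eqF ?sphere_radius_gt0//= => /eqP.
Qed.

Lemma is_derive_polar_point (f p : R -> R) (s df dp : R) :
  is_derive s 1 f df -> is_derive s 1 p dp ->
  is_derive s 1 (fun t => polar_point (f t) (p t)) (polar_point df dp).
Proof.
move=> fd pd.
have cd i j : is_derive s 1 (fun t => polar_point (f t) (p t) i j)
    (polar_point df dp i j).
  rewrite (_ : (fun t => _) = fun t => [:: f t; p t]`_j); last first.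
    by apply/funext => t; rewrite mxE.
  by rewrite mxE; case: j => [[|[|[|//]]] jj].
have ud : derivable (fun t => polar_point (f t) (p t)) s 1.
  by apply/derivable_mxP => i j; have [] := cd i j.
apply: DeriveDef => //; rewrite derive_mx//; apply/matrixP => i j.
by rewrite mxE; have [_ ->] := cd i j.
Qed.

Section Converse.
Variables (C s0 phi0 : R).
Hypothesis formulas : angle_formulas C s0 phi0.
Local Notation ka := (h * C).
Local Notation rho := (Num.sqrt (1 - h ^+ 2 * C ^+ 2)).
Local Notation al := (phi0 - pi / 2).
Local Notation cs s := (cos (h * (s - s0))).
Local Notation sn s := (sin (h * (s - s0))).

Let rho2 : rho ^+ 2 = 1 - ka ^+ 2.
Proof. by have [C1 _ _ _] := formulas; rewrite sqr_sqrtr ?subr_ge0// exprMn. Qed.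

Let latitude s : I s -> m ord_max s = rho * cs s.
Proof.
move=> Is; have [_ /(_ s Is) + _ _] := formulas.
have [_ _ ->] := sphere_polar Is => /(mulfI (invr_neq0 h0)) E1.
have /andP[m1 m2] := sphere_latitude Is.
rewrite -[LHS]acosK; last by rewrite in_itv/= !ltW.
rewrite E1 acosK// in_itv/=.
have c2 := cos2Dsin2 (h * (s - s0)); have r2 := rho2.
have : (rho * cs s) ^+ 2 <= 1.
  rewrite exprMn; have := sqr_ge0 (sn s); have := sqr_ge0 (cs s).
  have := sqr_ge0 ka; nra.
by move: (_ * _) => z z1; apply/andP; split; rewrite leNgt; apply/negP => ?; nra.
Qed.

Let radius2 s : I s -> sphere_radius (c s) ^+ 2 = 1 - (rho * cs s) ^+ 2.
Proof. by move=> Is; rewrite sphere_radius2// latitude. Qed.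

Let th s : R := phi s - al.

Let th_continuous s : I s -> {for s, continuous th}.
Proof.
by move=> Is; apply: continuousB; [exact: phi_continuous|exact: cst_continuous].
Qed.

Let relation s : I s -> sin (th s) * (ka * cs s) = cos (th s) * sn s.
Proof.
move=> Is; have [_ _ branch line] := formulas.
have [C0|C0] := eqVneq C 0.
  rewrite /th (line C0 s Is) opprB addrC subrK cos_pihalf C0.
  by rewrite mulr0 !mul0r mulr0.
have [theta [[thc br] phiE]] := branch C0.
have E1 t : I t -> th t = theta t by move=> It; rewrite /th (phiE t It); ring.
rewrite (E1 s Is).
apply: (branch_relation I_open h0 (ka := ka)) Is => //.
- by rewrite mulf_neq0.
- exact/(within_open_continuous I_open).
Qed.

(** For [C = 0] the angle [th] is the constant [pi / 2], which satisfies the same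
    relation as the branches of the arctangent. *)
Lemma converse_great_circle : exists2 e : R, e ^+ 2 = 1 & forall s, I s ->
  sphere_radius (c s) * cos (th s) = e * (ka * cs s) /\
  sphere_radius (c s) * sin (th s) = e * sn s.
Proof.
apply: (circle_of_angle I_itv th_continuous) => //.
  by move=> s Is; exact: sphere_radius_gt0.
move=> s Is; rewrite radius2// exprMn rho2.
by rewrite -{1}(cos2Dsin2 (h * (s - s0))); ring.
Qed.

Variable e : R.
Hypothesis e2 : e ^+ 2 = 1.
Hypothesis circle : forall s, I s ->
  sphere_radius (c s) * cos (th s) = e * (ka * cs s) /\
  sphere_radius (c s) * sin (th s) = e * sn s.

Let a k := triple (e * ka * cos al) (e * ka * sin al) rho k.
Let b k := triple (- (e * sin al)) (e * cos al) 0 k.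

Let sphereE k s : I s -> m k s = a k * cs s + b k * sn s.
Proof.
move=> Is; have [m0 m1 _] := sphere_polar Is; have [cE sE] := circle Is.
have phiE : phi s = th s + al by rewrite /th subrK.
case: k => [[|[|[|//]]] kk].
- rewrite (_ : Ordinal kk = 0); last exact/val_inj.
  rewrite m0 phiE cosD mulrBr !mulrA cE sE /a /b /triple/=; ring.
- rewrite (_ : Ordinal kk = 1); last exact/val_inj.
  rewrite m1 phiE sinD mulrDr !mulrA cE sE /a /b /triple/=; ring.
- rewrite (_ : Ordinal kk = ord_max); last exact/val_inj.
  by rewrite latitude// /a /b /triple/= mul0r addr0.
Qed.

Let sphere_derive k s : I s -> is_derive s 1 (m k) (h * (b k * cs s - a k * sn s)).
Proof.
move=> Is.
have d := is_deriveD (is_deriveZ (a k) (is_derive_cos_affine h s0 s))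
  (is_deriveZ (b k) (is_derive_sin_affine h s0 s)).
apply: near_eq_is_derive (is_derive_eq d _).
  apply: near_imp (open_nbhs_nbhs (conj I_open Is)) => t It.
  by rewrite (sphereE k It).
rewrite -![_ *: _]/(_ * _).
by move: (a k) (b k) (cs s) (sn s) => *; ring.
Qed.

Let sphere_derive2 k s : I s -> derive1 (derive1 (m k)) s = - (h ^+ 2 * m k s).
Proof.
move=> Is.
have E1 : \forall t \near s, derive1 (m k) t = h * (b k * cs t - a k * sn t).
  apply: near_imp (open_nbhs_nbhs (conj I_open Is)) => t It.
  by have [_] := sphere_derive k It; rewrite derive1E.
have d := is_deriveZ h (is_deriveB
  (is_deriveZ (b k) (is_derive_cos_affine h s0 s))
  (is_deriveZ (a k) (is_derive_sin_affine h s0 s))).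
have [_ dE] := d.
rewrite (near_derive1 E1) derive1E [LHS]dE sphereE//.
rewrite -![_ *: _]/(_ * _).
by move: (a k) (b k) (cs s) (sn s) => *; ring.
Qed.

Let speed s : I s -> \sum_k derive1 (m k) s ^+ 2 = h ^+ 2.
Proof.
move=> Is.
have E1 k : derive1 (m k) s = h * (b k * cs s - a k * sn s).
  by have [_] := sphere_derive k Is; rewrite derive1E.
rewrite sum_ord3 !E1 /a /b /triple/=.
have ac := cos2Dsin2 al; have tc := cos2Dsin2 (h * (s - s0)); have r2 := rho2.
move: (cos al) (sin al) (cs s) (sn s) (rho) ac tc r2 => ca sa ct st r ac tc r2.
transitivity (h ^+ 2 * (e ^+ 2 * (ca ^+ 2 + sa ^+ 2) * (ct ^+ 2 + ka ^+ 2 * st ^+ 2)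
  + r ^+ 2 * st ^+ 2)); first by ring.
rewrite e2 ac r2; transitivity (h ^+ 2 * (ct ^+ 2 + st ^+ 2)); first by ring.
by rewrite tc mulr1.
Qed.

Let D s : R := 1 - (rho * cs s) ^+ 2.

Let D_gt0 s : I s -> 0 < D s.
Proof. by move=> Is; rewrite /D -radius2// exprn_gt0// sphere_radius_gt0. Qed.

Let D_derive (s : R) : is_derive s 1 D (2 * rho ^+ 2 * h * (cs s * sn s)).
Proof.
have d := is_derive_cos_affine h s0 s.
have := is_deriveB (is_derive_cst (1 : R) s (1 : R))
  (is_deriveZ (rho ^+ 2) (is_derive_mulf d d)).
rewrite (_ : _ - _ = D).
  move=> /is_derive_eq; apply; rewrite -[_ *: _]/(_ * _).
  by move: (cs s) (sn s) (rho) => *; ring.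
by apply/funext => t; rewrite /D exprMn expr2.
Qed.

Let latitude_derive s : I s ->
  is_derive s 1 (fun t => acos (rho * cs t))
    (h * rho * (sn s * (Num.sqrt (D s))^-1)).
Proof.
move=> Is; have d := is_deriveZ rho (is_derive_cos_affine h s0 s).
have lat : -1 < rho * cs s < 1 by rewrite -latitude//; exact: sphere_latitude.
apply: is_derive_eq
  (is_deriveR1 (f := fun t => rho * cs t) (is_derive1_acos lat) d) _.
rewrite -/(D s) -[_ *: _]/(_ * _).
by move: (Num.sqrt (D s))^-1 (sn s) (rho) => *; ring.
Qed.

Let azimuth_derive s : I s -> is_derive s 1 phi (h * ka * (D s)^-1).
Proof.
move=> Is.
have ad := is_deriveZ (e * ka) (is_derive_cos_affine h s0 s).
have bd := is_deriveZ e (is_derive_sin_affine h s0 s).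
have rad0 t : I t -> 0 < sphere_radius (c t) by exact: sphere_radius_gt0.
have aE t : I t -> e * ka * cs t = sphere_radius (c t) * cos (th t).
  by move=> It; have [-> _] := circle It; rewrite -(mulrA e).
have bE t : I t -> e * sn t = sphere_radius (c t) * sin (th t).
  by move=> It; have [_ ->] := circle It.
have d := is_derive_angle I_open Is th_continuous rad0 aE bE ad bd.
have -> : phi = fun t => al + th t by apply/funext => t; rewrite /th addrC subrK.
apply: is_derive_eq (is_deriveD (is_derive_cst al s 1) d) _.
rewrite add0r radius2// -/(D s) -![_ *: _]/(_ * _).
have tc := cos2Dsin2 (h * (s - s0)).
rewrite (_ : _ - _ = e ^+ 2 * (h * ka) * (cs s ^+ 2 + sn s ^+ 2)).
  by rewrite e2 tc mul1r mulr1.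
by move: (cs s) (sn s) => *; ring.
Qed.

Let u s := polar_point (acos (rho * cs s)) (phi s).

Let du s := polar_point (h * rho * (sn s * (Num.sqrt (D s))^-1))
  (h * ka * (D s)^-1).

Let u_derive s : I s -> is_derive s 1 u (du s).
Proof.
by move=> Is; apply: is_derive_polar_point; [exact: latitude_derive|exact: azimuth_derive].
Qed.

Let u_derivable2 s : I s -> derivable (derive1 u) s 1.
Proof.
move=> Is; have D0 := D_gt0 Is.
have sd := is_deriveR1 (f := D) (is_derive1_sqrt D0) (D_derive s).
have s_neq0 : Num.sqrt (D s) != 0 by rewrite gt_eqF// sqrtr_gt0.
have d1 := is_deriveZ (h * rho) (is_derive_mulf
  (is_derive_sin_affine h s0 s) (is_deriveV (f := fun t => Num.sqrt (D t)) s_neq0 sd)).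
have d2 := is_deriveZ (h * ka) (is_deriveV (f := D) (lt0r_neq0 D0) (D_derive s)).
have [dd _] := is_derive_polar_point d1 d2.
apply: near_eq_derivable dd.
apply: near_imp (open_nbhs_nbhs (conj I_open Is)) => t It.
by have [_ E1] := u_derive It; rewrite derive1E [RHS]E1.
Qed.

Let curve_chart s : I s -> 0 < acos (rho * cs s) < pi /\ c s = polar_chart F x E (u s).
Proof.
move=> Is; have [_ /(_ s Is)[f0 f1]] := hphi.
have := polar_chart_onto hx hE (hc Is) (hq Is) f0 f1.
by rewrite /u -latitude.
Qed.

(** The hypothesis on the sign [e] makes each component of the image curve a
    combination of [cos t] and [sin t], so that [m'' = - h ^ 2 m]; the chart is
    centred at the value of [phi] so that nearby points stay in its domain. *)
Lemma converse_geodesic : geodesic S G I c /\ arc_length_param G I c.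
Proof.
have chart_u s t : I t -> `|phi t - phi s| < pi / 2 ->
    polar_domain (phi s) (u t).
  move=> It; rewrite ltr_norml => /andP[p1 p2].
  have [/andP[f0 f1] _] := curve_chart It.
  by rewrite /polar_domain/= !mxE.
have near_good s : I s -> \forall t \near s, I t /\ `|phi t - phi s| < pi / 2.
  move=> Is; have Is' := open_nbhs_nbhs (conj I_open Is).
  have close : \forall t \near s, `|phi s - phi t| < pi / 2.
    have pi0 : 0 < pi / 2 :> R by rewrite divr_gt0// pi_gt0.
    by have /cvgrPdist_lt/(_ _ pi0) := phi_continuous Is.
  by apply: near_imp2 Is' close => t It; rewrite distrC.
split=> s Is.
  have : nbhs s [set t | I t /\ `|phi t - phi s| < pi / 2] by exact: near_good.
  rewrite nbhsE => -[J [Jo Js] JP].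
  exists (polar_domain (phi s)), (polar_chart F x E), J, u.
  split; [exact: polar_local_chart|by []|by []|].
  move=> t Jt; have [It pt] := JP t Jt; have [_ ct] := curve_chart It.
  split=> //; first exact: chart_u.
  have Jt' := open_nbhs_nbhs (conj Jo Jt).
  apply: (geodesic_of_accel hx hE hq (polar_local_chart hx hE (phi s)) It).
  - apply: near_imp Jt' => r /JP[Ir pr].
    by split; [exact: chart_u|have [] := curve_chart Ir].
  - by apply: near_imp Jt' => r /JP[Ir _]; have [] := u_derive Ir.
  - exact: u_derivable2.
  - by move=> k; exact: sphere_derive2.
have cd : derivable c s 1.
  have Yd : differentiable (polar_chart F x E) (u s).
    exact: ((polar_chart_Ck F x E 1 setT).1 (u s) Logic.I).
  have [d _] := is_derive_chain (u_derive Is) Yd.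
  apply: near_eq_derivable d.
  apply: near_imp (open_nbhs_nbhs (conj I_open Is)) => t It.
  by have [_ ->] := curve_chart It.
by split=> //; rewrite (sphere_speed hx hE I_open hc hq Is cd) speed// mulVf// expf_neq0.
Qed.

End Converse.

Lemma angle_formulas_geodesic C s0 phi0 : angle_formulas C s0 phi0 ->
  geodesic S G I c /\ arc_length_param G I c.
Proof.
move=> formulas; have [e e2 circ] := converse_great_circle formulas.
exact: (converse_geodesic formulas e2 circ).
Qed.

End Geodesics.

Theorem theorem2p8 (R : realType) (F : finsleroid_space R)
    (x : 'rV[R]_3) (hx : dom F x)
    (E : 'M[R]_3) (hE : adapted_frame F x E)
    (I : set R) (I_open : open I) (I_itv : is_interval I)
    (c : R -> 'rV[R]_3) (phi : R -> R)
    (hc : forall s, I s -> indicatrix F x (c s))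
    (hq : forall s, I s -> fq F x (c s) != 0)
    (hphi : polar_angle_along F x E I c phi) :
  let h := fh F x in
  geodesic (indicatrix F x) (metric_tensor F x) I c /\
  arc_length_param (metric_tensor F x) I c
  <->
  exists C s0 phi0 : R,
    [/\ h ^+ 2 * C ^+ 2 <= 1,
        forall s, I s ->
          chi F x (c s) =
          h^-1 * acos (Num.sqrt (1 - h ^+ 2 * C ^+ 2) * cos (h * (s - s0))),
        C != 0 ->
          exists theta : R -> R,
            arctan_branch I [set s | cos (h * (s - s0)) != 0]
              (fun s => (h * C)^-1 * tan (h * (s - s0))) theta /\
            forall s, I s -> phi s = phi0 - pi / 2 + theta s
      & C = 0 -> forall s, I s -> phi s = phi0].
Proof.
split=> [[geo arc]|[C [s0 [phi0 formulas]]]].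
  exact: (geodesic_angle_formulas hx hE I_open I_itv hc hq hphi geo arc).
exact: (angle_formulas_geodesic hx hE I_open I_itv hc hq hphi formulas).
Qed.
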